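(* Let $C$ be a $d$-dimensional Archimedean copula with strict generator $\psi$ and let $\ell\in\{1,\ldots,d-2\}$. If $C$ is conditionally increasing, then so is the conditional copula $C^{\mathbf{x}}$ for any $\mathbf{x}\in(0,1)^\ell$.
   Context: $\mathbb{I}=[0,1]$. Archimedean copulas: a generator is a continuous, non-increasing function $\psi:[0,\infty)\to\mathbb{I}$ with $\psi(0)=1$, $\lim_{z\to\infty}\psi(z)=0$, strictly decreasing on $[0,\inf\{z\in[0,\infty]:\psi(z)=0\}]$ (with $\psi(\infty):=0$). $\varphi:(0,1]\to[0,\infty)$ denotes the pseudoinverse of $\psi$, and $\varphi(0):=\inf\{z\in[0,\infty]:\psi(z)=0\}\in(0,\infty]$. A $d$-dimensional copula $C$ is Archimedean with generator $\psi$ if $C(\mathbf{x})=\psi(\varphi(x_1)+\cdots+\varphi(x_d))$ for all $\mathbf{x}\in\mathbb{I}^d$; $C$ (and $\psi$) is strict if $\varphi(0)=\infty$. The right-hand side is a copula if and only if $\psi$ is $d$-monotone: $\psi$ is continuous on $[0,\infty)$, has derivatives $\psi^{(m)}$ up to order $d-2$ on $(0,\infty)$ with $(-1)^m\psi^{(m)}\ge0$ for $m=0,\ldots,d-2$, and $(-1)^{d-2}\psi^{(d-2)}$ is non-increasing and convex on $(0,\infty)$. Generators are normalized so that $\psi(1)=\frac12$. Conditional copula: let $C$ be strict with generator $\psi$, $\ell\in\{1,\ldots,d-2\}$ and $\mathbf{x}\in(0,1)^\ell$. The $\ell$-Markov kernel of $C$ (regular conditional distribution of the last $d-\ell$ coordinates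 given the first $\ell$) is taken in the version $$K_C(\mathbf{x},[\mathbf{0},\mathbf{y}])=\frac{\psi^{(\ell)}\left(\sum_{i=1}^\ell\varphi(x_i)+\sum_{j=1}^{d-\ell}\varphi(y_j)\right)}{\psi^{(\ell)}\left(\sum_{i=1}^\ell\varphi(x_i)\right)},\qquad \mathbf{y}\in\mathbb{I}^{d-\ell},$$ with $\psi^{(\ell)}(\infty):=0$. Its univariate marginal distribution functions all equal $g_{\mathbf{x}}(y)=\psi^{(\ell)}\left(\sum_{i=1}^\ell\varphi(x_i)+\varphi(y)\right)/\psi^{(\ell)}\left(\sum_{i=1}^\ell\varphi(x_i)\right)$, which is an increasing bijection of $\mathbb{I}$ with inverse $g_{\mathbf{x}}^{-1}$. The conditional copula $C^{\mathbf{x}}$ is the copula of $K_C(\mathbf{x},\cdot)$, i.e. $$C^{\mathbf{x}}(\mathbf{u})=K_C(\mathbf{x},[0,g_{\mathbf{x}}^{-1}(u_1)]\times\cdots\times[0,g_{\mathbf{x}}^{-1}(u_{d-\ell})]),\qquad\mathbf{u}\in\mathbb{I}^{d-\ell}.$$ Conditionally increasing: a $k$-dimensional copula $A$ is conditionally increasing if, for $\mathbf{X}=(X_1,\ldots,X_k)\sim A$, the variable $X_i$ is stochastically increasing in $(X_p)_{p\in J}$ for all $J\subset\{1,\ldots,k\}$ and all $i\notin J$; that is, there is a version of the conditional distribution of $X_i$ given $(X_p)_{p\in J}$ such that for all $y\in\mathbb{I}$ the map $\mathbf{s}\mapsto\mathbb{P}(X_i\le y\mid (X_p)_{p\in J}=\mathbf{s})$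 is decreasing (non-increasing in each coordinate). *)

(* Defs.v *)
From HB Require Import structures.
From mathcomp Require Import all_boot all_order all_algebra.
From mathcomp Require Import all_classical all_reals all_analysis.

Set Implicit Arguments.
Unset Strict Implicit.
Unset Printing Implicit Defensive.

Import Order.TTheory GRing.Theory Num.Theory.
Import numFieldNormedType.Exports.

Local Open Scope classical_set_scope.
Local Open Scope ring_scope.

(** Copulas are functions on [k.-tuple R], only their values on [0,1]^k are
    relevant. *)
Definition in_cube (R : realType) (k : nat) (u : k.-tuple R) : Prop :=
  forall i, 0 <= tnth u i <= 1.

Section generators.
Context {R : realType}.
Implicit Types psi : R -> R.

(** The pseudoinverse of [psi], with values in [0,+oo]. Since [psi 0 = 1] and
    [psi] is continuous and vanishes at infinity, the set below is nonempty for
    [0 < t <= 1]; for [t = 0] it may be empty, and its infimum is then [+oo]. *)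
Definition gen_pinv psi (t : R) : \bar R :=
  ereal_inf [set z%:E | z in [set z | 0 <= z /\ psi z = t]].

(** Extension of a function to [+oo] by the value 0. *)
Definition ext_pinfty (f : R -> R) (z : \bar R) : R :=
  if z is r%:E then f r else 0.

(** In [gen_decr] the right end point [b] is finite: if [gen_pinv psi 0 = +oo],
    the comparison with the value 0 at [+oo] holds as [psi] has no zero. *)
Record generator psi : Prop := Generator {
  gen_cont : {within `[0, +oo[, continuous psi};
  gen_range : forall z, 0 <= z -> 0 <= psi z <= 1;
  gen_noninc : forall a b, 0 <= a -> a <= b -> psi b <= psi a;
  gen_at0 : psi 0 = 1;
  gen_lim : psi z @[z --> +oo] --> (0 : R);
  gen_decr : forall a b, 0 <= a -> a < b -> (b%:E <= gen_pinv psi 0)%E ->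
    psi b < psi a;
  gen_norm : psi 1 = 2^-1 }.

Definition strict_generator psi : Prop := gen_pinv psi 0 = +oo%E.

(** Meant for [2 <= d]: [d - 2] is a truncated subtraction. *)
Record d_monotone (d : nat) psi : Prop := DMonotone {
  dmon_cont : {within `[0, +oo[, continuous psi};
  dmon_derivable : forall m, (m < d - 2)%N -> forall z, 0 < z ->
    derivable (derive1n m psi) z 1;
  dmon_sign : forall m, (m <= d - 2)%N -> forall z, 0 < z ->
    0 <= (-1) ^+ m * derive1n m psi z;
  dmon_noninc : forall a b, 0 < a -> a <= b ->
    (-1) ^+ (d - 2) * derive1n (d - 2) psi b <= (-1) ^+ (d - 2) * derive1n (d - 2) psi a;
  dmon_convex : convex_function (`]0, +oo[%classic : set R)
    (fun z => (-1) ^+ (d - 2) * derive1n (d - 2) psi z) }.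

End generators.

Definition sum_pinv {R : realType} (psi : R -> R) (n : nat) (y : n.-tuple R)
    : \bar R :=
  (\sum_(j < n) gen_pinv psi (tnth y j))%E.

Section copulas.
Context {R : realType}.

(** [mu] is a law on R^k with uniform margins on [0,1] whose distribution
    function is [A] on [0,1]^k. *)
Definition copula_law (k : nat) (A : k.-tuple R -> R)
    (mu : set (k.-tuple R) -> \bar R) : Prop :=
  (forall (i : 'I_k) (E : set R), measurable E ->
    mu [set v | E (tnth v i)] = uniform_prob (@ltr01 R) E) /\
  (forall u : k.-tuple R, in_cube u ->
    mu [set v | forall i, tnth v i <= tnth u i] = (A u)%:E).

Definition is_copula (k : nat) (A : k.-tuple R -> R) : Prop :=
  exists mu : probability (k.-tuple R) R, copula_law A mu.

Definition archimedean_copula (d : nat) (psi : R -> R) (C : d.-tuple R -> R)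
    : Prop :=
  [/\ generator psi, d_monotone d psi, is_copula C &
      forall u : d.-tuple R, in_cube u ->
        C u = ext_pinfty psi (sum_pinv psi u)].

(** [kappa] is a version of the regular conditional distribution of [Y]
    given [Z]. *)
Definition is_cond_distribution dT (T : measurableType dT)
    (P : probability T R) dZ (S : measurableType dZ) (Y : T -> R) (Z : T -> S)
    (kappa : R.-pker S ~> R) : Prop :=
  forall (B : set S) (E : set R), measurable B -> measurable E ->
    P (Z @^-1` B `&` Y @^-1` E) = (\int[P]_(w in Z @^-1` B) kappa (Z w) E)%E.

(** The monotonicity is required on [0,1]^n, for [Y] and the coordinates of [Z]
    taking values in [0,1]. *)
Definition stoch_increasing dT (T : measurableType dT) (P : probability T R)
    (n : nat) (Y : T -> R) (Z : T -> n.-tuple R) : Prop :=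
  exists2 kappa : R.-pker (n.-tuple R) ~> R,
    is_cond_distribution P Y Z kappa &
    forall y : R, 0 <= y <= 1 -> forall s t : n.-tuple R,
      in_cube s -> in_cube t -> (forall j, tnth s j <= tnth t j) ->
      (kappa t `]-oo, y]%classic <= kappa s `]-oo, y]%classic)%E.

(** The coordinates of [v] with index in [J], in increasing order. *)
Definition subvec (k : nat) (J : {set 'I_k}) (v : k.-tuple R) : #|J|.-tuple R :=
  [tuple tnth v (enum_val j) | j < #|J|].

(** Stated for all random vectors with distribution function [A]; their common
    law is determined by [A]. *)
Definition conditionally_increasing (k : nat) (A : k.-tuple R -> R) : Prop :=
  forall dT (T : measurableType dT) (P : probability T R)
    (X : {RV P >-> k.-tuple R}), copula_law A (distribution P X) ->
  forall (J : {set 'I_k}) (i : 'I_k), i \notin J ->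
    stoch_increasing P (fun w => tnth (X w) i) (fun w => subvec J (X w)).

End copulas.

Section conditional_copula.
Context {R : realType} (psi : R -> R) (l : nat) (x : l.-tuple R).

(** [K_C(x, [0,y])] for the Archimedean copula [C] with generator [psi]. *)
Definition markov_df (n : nat) (y : n.-tuple R) : R :=
  ext_pinfty (derive1n l psi) (sum_pinv psi x + sum_pinv psi y)%E
  / ext_pinfty (derive1n l psi) (sum_pinv psi x).

Definition markov_margin (y : R) : R :=
  ext_pinfty (derive1n l psi) (sum_pinv psi x + gen_pinv psi y)%E
  / ext_pinfty (derive1n l psi) (sum_pinv psi x).

(** [markov_margin] is a bijection of [0,1], [markov_quantile] its inverse. *)
Definition markov_quantile : R -> R := 'pinv_(fun=> 0) `[0, 1]%classic markov_margin.

Definition cond_copula (n : nat) (u : n.-tuple R) : R :=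
  markov_df [tuple markov_quantile (tnth u j) | j < n].

End conditional_copula.

(* Main.v *)
Require Import Defs.
From HB Require Import structures.
From mathcomp Require Import all_boot all_order all_algebra.
From mathcomp Require Import all_classical all_reals all_analysis.
From mathcomp Require Import measurable_realfun.
From mathcomp Require Import ring lra zify.
Set Implicit Arguments.
Unset Strict Implicit.
Unset Printing Implicit Defensive.
Import Order.TTheory GRing.Theory Num.Theory.
Import numFieldNormedType.Exports.
Local Open Scope classical_set_scope.
Local Open Scope ring_scope.

(** Put [f_k = (-1)^k psi^(k)], where [f_(d-1)] is the right slope of
    [- f_(d-2)]. If [X ~ C] and [X_j = psi(Z_j)], then [Z] has survival function
    [psi(z_1 + ... + z_d)], so the probability of a box in the coordinates [J] is
    an iterated difference of [psi], which lies between the volume of the box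
    times the values of [f_#|J|] at its two extreme corners. The conditional
    probability of [Z_i >= y] given [Z_J] being monotone, comparing small boxes
    shows that [t |-> f_m(t + y) / f_m(t)] is nondecreasing for
    [1 <= m <= d - 1], that is, [f_m] is log-convex.

    The conditional copula has the same structure, with generator
    [t |-> f_l(s + t) / f_l(s)] where [s = phi(x_1) + ... + phi(x_l)], and its
    towers of derivatives consist of shifts of the [f_(l+m)]. Log-convexity makes
    [P(Z_i >= y | Z_J) = f_(l+m)(s + |Z_J| + y) / f_(l+m)(s + |Z_J|)], [m = #|J|],
    monotone. That this formula is the conditional law is proved without
    densities: on a small box both sides agree up to its volume times the
    oscillation of [f_(l+m)], and additivity over subdivisions removes the
    error. *)

(** * Towers of derivatives and iterated differences *)

(** Two gaps shape the argument. Conditioning on up to [d - 1] coordinates involves order [d - 1],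
    while d-monotonicity gives derivatives up to [d - 2] only, so the last function is reached
    through difference quotients and every estimate is a two-sided bound. A conditional law is fixed
    up to null sets only, so its monotonicity is exploited on cells of positive width; the resulting
    shift is removed by right continuity of the [f_m]. Log-convexity then repays the missing
    regularity: it gives even [f_(d-1)] a uniform modulus of continuity away from 0. The indices
    fit: an empty [J] yields nothing about [f_0], but [l >= 1] makes [l + #|J|] positive, and
    [i \notin J] keeps it at most [d - 1]. Finally [x_i < 1] gives [s > 0], so the shifted functions
    live on []-s, +oo[] and stay bounded near 0, even where the [f_(l+m)] blow up at 0. *)

Section tower.
Context {R : realType}.
Implicit Types (lo c t : R) (F r : R -> R) (f : nat -> R -> R) (s : seq R).

(** A substitute for [F' = - r] that makes sense when [F] is merely convex: [- r] selects a
    subgradient of [F] at each point. *)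
Definition slope_between lo F r := forall a b, lo < a -> a <= b ->
  r b * (b - a) <= F a - F b <= r a * (b - a).

(** Derivatives stop one level before slopes do: [f n] is tied to [f n.-1] by slopes only, since the
    right slope of a convex function need not be its derivative. *)
Record tower lo (n : nat) f : Prop := Tower {
  tower_deriv : forall k, (k.+1 < n)%N -> forall t, lo < t ->
    is_derive t 1 (f k) (- f k.+1 t);
  tower_slope : forall k, (k < n)%N -> slope_between lo (f k) (f k.+1);
  tower_gt0 : forall k t, (k <= n)%N -> lo < t -> 0 < f k t }.

(** The inclusion-exclusion sum over the corners of a box with side lengths [s], for a function of
    the sum of the coordinates; the sign makes it nonnegative along a tower. *)
Fixpoint iter_diff s F t : R :=
  if s is h :: s' then iter_diff s' F t - iter_diff s' F (t + h) else F t.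

Lemma slope_between_noninc lo F r a b : slope_between lo F r ->
  lo < a -> a <= b -> r b <= r a.
Proof.
move=> Fr la; rewrite le_eqVlt => /predU1P[->//|ab].
have /andP[h1 h2] := Fr _ _ la (ltW ab).
by have := le_trans h1 h2; rewrite ler_pM2r// subr_gt0.
Qed.

Lemma tower_decreasing lo n f k a b : tower lo n f -> (k < n)%N ->
  lo < a -> a < b -> f k b < f k a.
Proof.
move=> tw kn la ab; have /andP[h _] := tower_slope tw kn la (ltW ab).
rewrite -subr_gt0; apply: lt_le_trans h.
by rewrite mulr_gt0 ?subr_gt0// (tower_gt0 tw)// (lt_trans la).
Qed.

(** [F] is Lipschitz with constant [r m] to the right of the midpoint [m], because [r] does not
    increase; near [lo] itself [r] may be unbounded. *)
Lemma slope_between_continuous lo F r t : slope_between lo F r -> lo < t ->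
  (forall x, lo < x -> 0 <= r x) -> {for t, continuous F}.
Proof.
move=> Fr lt0 r0.
set m := (lo + t) / 2.
have lm : lo < m by rewrite /m; lra.
have mt : m < t by rewrite /m; lra.
have Lip a b : m < a -> a <= b -> `|F a - F b| <= r m * (b - a).
  move=> ma ab.
  have la : lo < a by lra.
  have /andP[h1 h2] := Fr _ _ la ab.
  have h3 := slope_between_noninc Fr lm (ltW ma).
  rewrite ger0_norm; last first.
    apply: le_trans h1; rewrite mulr_ge0 ?subr_ge0// r0//.
    by rewrite (lt_le_trans la).
  by apply: le_trans h2 _; rewrite ler_wpM2r ?subr_ge0.
apply/cvgrPdist_le => e e0.
have K0 : 0 < r m + 1 by rewrite ltr_wpDl ?r0.
near=> x.
have xm : m < x by near: x; exact: lt_nbhsr.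
have xt : `|t - x| <= e / (r m + 1).
  near: x; apply: cvgr_dist_le => //; exact: divr_gt0.
have : `|F t - F x| <= r m * `|t - x|.
  have [tx|xt'] := leP t x.
    by rewrite (distrC t x) (@ger0_norm _ (x - t)) ?subr_ge0//; exact: (Lip _ _ mt tx).
  by rewrite distrC (@ger0_norm _ (t - x)) ?subr_ge0 ?(ltW xt')//; exact: (Lip _ _ xm (ltW xt')).
move/le_trans; apply.
apply: le_trans (_ : (r m + 1) * `|t - x| <= _).
  by rewrite ler_wpM2r// lerDl.
by rewrite mulrC -ler_pdivlMr.
Unshelve. all: by end_near. Qed.

Lemma iter_diff_derive lo n f k s t : tower lo n f -> (k.+1 < n)%N ->
  all (>= 0) s -> lo < t ->
  is_derive t 1 (iter_diff s (f k)) (- iter_diff s (f k.+1) t).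
Proof.
move=> tw kn; elim: s t => [|h s IH] t /=; first by move=> _ lt0; apply: (tower_deriv tw).
move=> /andP[h0 s0] lt0.
have H2 : is_derive t 1 (fun x => iter_diff s (f k) (x + h))
            (- iter_diff s (f k.+1) (t + h)).
  have lth : lo < t + h by rewrite ltr_wpDr.
  have H := IH _ s0 lth.
  rewrite -[X in is_derive _ _ _ X]mulr1.
  have H3 : is_derive t 1 (fun x : R => x + h) 1.
    by rewrite -[X in is_derive _ _ _ X]addr0; apply: is_deriveD.
  exact: (@is_derive1_comp _ (iter_diff s (f k)) (fun x => x + h) _ _ _ H H3).
have H1 := IH _ s0 lt0.
by apply: (is_derive_eq (is_deriveB H1 H2)); ring.
Qed.

(** Each increment costs one level: the mean value theorem turns a difference of [f k] into [h]
    times a value at level [k.+1] in between, and monotonicity moves that value to the extreme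
    corners. *)
Lemma iter_diff_bound lo n f s t : tower lo n f -> (size s <= n)%N ->
  all (>= 0) s -> lo < t ->
  f (size s) (t + \sum_(h <- s) h) * \prod_(h <- s) h <= iter_diff s (f 0%N) t
    <= f (size s) t * \prod_(h <- s) h.
Proof.
move=> tw; suff H k : (k + size s <= n)%N -> all (>= 0) s -> lo < t ->
    f (k + size s)%N (t + \sum_(h <- s) h) * \prod_(h <- s) h <=
      iter_diff s (f k) t <= f (k + size s)%N t * \prod_(h <- s) h.
  by move=> sn; apply: (H 0%N).
elim: s k t => [|h s IH] k t /=.
  by rewrite !big_nil !addr0 addn0 !mulr1 lexx.
rewrite addnS => ksn /andP[h0 s0] lt0.
have ss0 : 0 <= \prod_(h <- s) h.
  by rewrite big_seq prodr_ge0// => x xs; exact: (allP s0).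
have Ss0 : 0 <= \sum_(h <- s) h.
  by rewrite big_seq sumr_ge0// => x xs; exact: (allP s0).
rewrite !big_cons.
(* The last increment may reach the top level, where no derivative is available; [slope_between]
   takes over from the mean value theorem. *)
have [s_nil|s_cons] := eqVneq (size s) 0%N.
  move/size0nil : s_nil => s_nil; subst s.
  rewrite /= !big_nil addn0 addr0 mulr1.
  rewrite /= addn0 in ksn.
  have := tower_slope tw ksn (b := t + h) lt0; rewrite lerDl => /(_ h0).
  by rewrite [t + h - t]addrC addKr.
have kn : (k.+1 < n)%N by rewrite (leq_trans _ ksn)// ltnS -[X in (X < _)%N]addn0 ltn_add2l lt0n.
have dD x : lo < x -> is_derive x 1 (iter_diff s (f k)) (- iter_diff s (f k.+1) x).
  by move=> lx; exact: iter_diff_derive tw kn s0 lx.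
have [|c||c] := @MVT_segment R (iter_diff s (f k)) (fun x => - iter_diff s (f k.+1) x) t (t + h).
- by rewrite lerDl.
- by rewrite in_itv/= => /andP[tc _]; apply: dD; exact: lt_trans tc.
- apply: derivable_within_continuous => x; rewrite in_itv/= => /andP[tx _];
  by have [] := dD x (lt_le_trans lt0 tx).
rewrite in_itv/= => /andP[tc ct] E.
have -> : iter_diff s (f k) t - iter_diff s (f k) (t + h) = h * iter_diff s (f k.+1) c.
  by rewrite -opprB E; ring.
have lc : lo < c by rewrite (lt_le_trans lt0).
have := IH k.+1 c; rewrite addSn => /(_ ksn s0 lc) /andP[H1 H2].
have sl : slope_between lo (f (k + size s)%N) (f (k + size s).+1) by exact: tower_slope tw _ _.
apply/andP; split.
  rewrite mulrCA ler_wpM2l//; apply: le_trans H1.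
  rewrite ler_wpM2r//; apply: slope_between_noninc sl _ _; last by rewrite addrA lerD2r.
  by rewrite ltr_wpDr.
rewrite mulrCA ler_wpM2l//; apply: le_trans H2 _.
by rewrite ler_wpM2r//; apply: slope_between_noninc sl _ _.
Qed.

End tower.

(** * Log-convexity *)

Section generator_tower.
Context {R : realType}.
Implicit Types (lo c t : R) (F r : R -> R) (f : nat -> R -> R) (s : seq R).

Definition log_convex_from lo r := forall t t' y, lo < t -> t <= t' -> 0 <= y ->
  r (t + y) * r t' <= r (t' + y) * r t.

(** For a nonincreasing [r] the bound [r (t + x) <= r t] is automatic, so this lower half amounts to
    right continuity. *)
Definition right_continuous_from lo r := forall t, lo < t -> forall e, 0 < e ->
  exists2 d, 0 < d & forall x, 0 < x -> x <= d -> r t - e <= r (t + x).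

(** The extra [x] is the width of the cells that produce the inequality; right continuity at [t + y]
    and [t'] lets it tend to 0. *)
Lemma log_convex_from_shifted lo r :
  (forall t, lo < t -> 0 < r t) -> right_continuous_from lo r ->
  (forall t t' y x, lo < t -> 0 < x -> t + x <= t' -> 0 <= y ->
    r (t + x + y) * r (t' + x) <= r (t' + y) * r t) ->
  log_convex_from lo r.
Proof.
move=> r0 rc H t t' y lt0; rewrite le_eqVlt => /predU1P[<-|tt'] y0.
  by rewrite mulrC.
have lt' : lo < t' by lra.
have lty : lo < t + y by lra.
set p := r (t + y); set q := r t'.
have p0 : 0 < p by exact: r0.
have q0 : 0 < q by exact: r0.
apply/ler_addgt0Pr => e e0.
have pq0 : 0 < p + q by lra.
(* Small enough that [(p - e1) * (q - e1)] has nonnegative factors and is at least [p * q - e]. *)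
pose e1 := Num.min (e / (p + q)) (Num.min p q).
have e10 : 0 < e1 by rewrite !lt_min divr_gt0//= p0 q0.
have [e1e [e1p e1q]] : e1 <= e / (p + q) /\ e1 <= p /\ e1 <= q.
  by rewrite !ge_min !lexx !orbT.
have [d1 d10 D1] := rc _ lty _ e10.
have [d2 d20 D2] := rc _ lt' _ e10.
pose x := Num.min (t' - t) (Num.min d1 d2).
have x0 : 0 < x by rewrite !lt_min subr_gt0 tt' d10.
have [x1 [x2 x3]] : x <= t' - t /\ x <= d1 /\ x <= d2.
  by rewrite !ge_min !lexx !orbT.
have := H t t' y x lt0 x0; rewrite -lerBrDl => /(_ x1 y0).
have := D1 _ x0 x2; have := D2 _ x0 x3; rewrite -/p -/q addrAC => h1 h2 h3.
have : (p - e1) * (q - e1) <= r (t' + y) * r t.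
  by apply: le_trans h3; apply: ler_pM => //; rewrite subr_ge0.
have : e1 * (p + q) <= e by rewrite -ler_pdivlMr.
have : 0 <= e1 * e1 by rewrite mulr_ge0// ltW.
nra.
Qed.

(** This supplies the continuity that the top of a tower lacks, uniformly on [[c, +oo[], so that one
    mesh size serves for boxes arbitrarily far out. *)
Lemma log_convex_modulus lo c r (e : R) : lo < c -> 0 < e ->
  (forall t, lo < t -> 0 < r t) ->
  (forall a b, lo < a -> a <= b -> r b <= r a) ->
  log_convex_from lo r ->
  exists2 d, 0 < d & forall a b, c <= a -> a <= b -> b <= a + d ->
    r a - r b <= e.
Proof.
move=> loc e0 r0 rni lc.
pose d := (c - lo) / 2; pose c0 := c - d.
have d0 : 0 < d by rewrite /d; lra.
have lc0 : lo < c0 by rewrite /c0 /d; lra.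
(* [N] equal steps lead from [c0] to [c]; with this many, [N%:R * (x * r c) <= r c0] caps the drop
   [x * r a] by [e]. *)
pose N := (Num.truncn (r c0 / e)).+1.
have N0 : (0 : R) < N%:R by rewrite ltr0n.
have NE : r c0 <= e * N%:R.
  rewrite mulrC -ler_pdivrMr//; apply/ltW; exact: truncnS_gt.
pose y := d / N%:R.
have y0 : 0 < y by rewrite divr_gt0.
exists y => // a b ca ab bay.
apply: le_trans (_ : r a - r (a + y) <= _).
  by rewrite lerB// rni// (lt_le_trans loc)// (le_trans ca).
have la : lo < a by rewrite (lt_le_trans loc).
have ra := r0 _ la.
pose x := 1 - r (a + y) / r a.
have x0 : 0 <= x.
  by rewrite subr_ge0 ler_pdivrMr// mul1r rni// lerDl ltW.
have qE : r (a + y) = (1 - x) * r a by rewrite /x subKr mulfVK// gt_eqF.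
have x1 : 0 <= 1 - x by rewrite /x subKr divr_ge0// ltW// r0// ltr_wpDr// ltW.
(* The ratios [r (u + y) / r u] increase with [u], so those along the grid
   [c0 + i y] are at most [1 - x], which bounds [x] by a Bernoulli argument. *)
have key i : (i <= N)%N -> r (c0 + i%:R * y) * (1 + i%:R * x) <= r c0.
  elim: i => [|i IH] iN; first by rewrite !mul0r !addr0 mulr1.
  apply: le_trans (IH (ltnW iN)).
  have Ny : N%:R * y = d by rewrite mulrC divfK// gt_eqF.
  have iy0 : 0 <= i%:R * y by rewrite mulr_ge0// ltW.
  have iya : c0 + i%:R * y <= a.
    have : i%:R * y <= N%:R * y by rewrite ler_wpM2r ?(ltW y0)// ler_nat ltnW.
    by rewrite Ny /c0; lra.
  have lciy : lo < c0 + i%:R * y by lra.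
  have := lc _ _ _ lciy iya (ltW y0); rewrite qE mulrAC ler_pM2r//.
  rewrite -addrA -[X in i%:R * y + X]mul1r -mulrDl natr1.
  have ri := r0 _ lciy.
  move=> h1.
  have i0 : (0 : R) <= i%:R by [].
  have ix0 : 0 <= i%:R * x by rewrite mulr_ge0.
  rewrite -natr1.
  apply: le_trans (_ : (1 - x) * r (c0 + i%:R * y) * (1 + (i%:R + 1) * x) <= _).
    by rewrite natr1 ler_wpM2r//; lra.
  rewrite mulrAC [leRHS]mulrC ler_wpM2r ?(ltW ri)//.
  have : 0 <= x * x by rewrite mulr_ge0.
  have : 0 <= i%:R * x * x by rewrite !mulr_ge0.
  lra.
have := key N (leqnn _).
have -> : c0 + N%:R * y = c by rewrite mulrC divfK ?gt_eqF// subrK.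
have rca : r a <= r c by exact: rni.
have rc : 0 < r c by exact: r0.
have -> : r a - r (a + y) = x * r a by rewrite qE; ring.
move=> h.
have h2 : N%:R * (x * r c) <= r c0.
  have -> : N%:R * (x * r c) = r c * (N%:R * x) by ring.
  by apply: le_trans h; rewrite ler_pM2l//; lra.
have h3 : x * r a <= x * r c by rewrite ler_wpM2l.
apply: le_trans h3 _; rewrite -(ler_pM2l N0); apply: le_trans h2 _.
by rewrite mulrC.
Qed.

(** If [r] vanished at [t], [F] could not fall below [F t] afterwards; if [r] stayed above [e], [F]
    would become nonpositive after the distance [F (lo + 1) / e]. *)
Lemma slope_between_gt0 lo F r : slope_between lo F r ->
  (forall t, lo < t -> 0 <= r t) ->
  (forall t, lo < t -> 0 < F t) -> (forall e, 0 < e -> exists2 t, lo < t & F t < e) ->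
  (forall t, lo < t -> 0 < r t) /\ (forall e, 0 < e -> exists2 t, lo < t & r t < e).
Proof.
move=> Fr r0 F0 Fe; split=> [t lt0|e e0].
  rewrite lt_neqAle r0// andbT; apply/eqP => rt.
  have [u lu Fu] := Fe _ (F0 _ lt0).
  have [tu|/ltW ut] := leP t u.
    have /andP[_] := Fr _ _ lt0 tu; rewrite -rt mul0r; lra.
  have /andP[+ _] := Fr _ _ lu ut.
  have : 0 <= r t * (t - u) by rewrite mulr_ge0 ?subr_ge0// r0.
  lra.
apply: contrapT => H.
have re t : lo < t -> e <= r t.
  by move=> lt0; rewrite leNgt; apply/negP => rt; apply: H; exists t.
have lt1 : lo < lo + 1 by lra.
have F1 := F0 _ lt1.
pose b := lo + 1 + F (lo + 1) / e.
have h : 0 < F (lo + 1) / e by rewrite divr_gt0.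
have lb : lo < b by rewrite /b; lra.
have /andP[+ _] := Fr (lo + 1) b lt1 ltac:(rewrite /b; lra).
have -> : b - (lo + 1) = F (lo + 1) / e by rewrite /b; ring.
have : F (lo + 1) <= r b * (F (lo + 1) / e).
  rewrite mulrA ler_pdivlMr// mulrC ler_wpM2r ?(ltW F1)//; exact: re.
have := F0 _ lb; lra.
Qed.

End generator_tower.

(** * The tower of a generator *)

Section right_slope.
Context {R : realType}.
Implicit Types (lo c t : R) (F r : R -> R).

(** Minus the right derivative of a convex [F]: the quotients grow as [h] shrinks, so their supremum
    is the limit at 0. *)
Definition right_slope F t := sup [set (F t - F (t + h)) / h | h in [set h | 0 < h]].

Definition convex_slopes lo F := forall a m b, lo < a -> a < m -> m < b ->
  (F m - F b) * (m - a) <= (F a - F m) * (b - m).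

Lemma convex_function_slopes F :
  convex_function (`]0, +oo[%classic : set R) F -> convex_slopes 0 F.
Proof.
move=> cF a m b a0 am mb.
have ba : 0 < b - a by lra.
pose p := (b - m) / (b - a).
have p0 : 0 <= p by rewrite divr_ge0 ?ltW// subr_gt0.
have p1 : p <= 1 by rewrite ler_pdivrMr// mul1r; lra.
have : F (p * a + (1 - p) * b) <= p * F a + (1 - p) * F b.
  by apply: (cF (Itv01 p0 p1) a b); rewrite inE/= in_itv/= andbT; lra.
have -> : p * a + (1 - p) * b = m by rewrite /p; field; rewrite gt_eqF.
have bpE : b - m = p * (b - a) by rewrite /p divfK// gt_eqF.
have maE : m - a = (1 - p) * (b - a) by rewrite mulrBl -bpE; ring.
move=> h; rewrite bpE maE (mulrA _ p) (mulrA _ (1 - p)) ler_pM2r//; lra.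
Qed.

Lemma right_slope_sup lo F t : lo < t -> convex_slopes lo F ->
  has_sup [set (F t - F (t + h)) / h | h in [set h | 0 < h]].
Proof.
move=> lt0 cF; split; first by exists ((F t - F (t + 1)) / 1); exists 1 => /=.
pose a := (lo + t) / 2.
exists ((F a - F t) / (t - a)) => _ [h /= h0 <-].
rewrite ler_pdivrMr// mulrAC ler_pdivlMr; last by rewrite /a; lra.
have e : t + h - t = h by ring.
by have := cF a t (t + h); rewrite e; apply; rewrite /a; lra.
Qed.

Lemma right_slope_between lo F : convex_slopes lo F ->
  slope_between lo F (right_slope F).
Proof.
move=> cF a b la; rewrite le_eqVlt => /predU1P[->|ab].
  by rewrite !subrr !mulr0 lexx.
have ba : 0 < b - a by rewrite subr_gt0.
have lb : lo < b by exact: lt_trans ab.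
apply/andP; split; last first.
  rewrite -ler_pdivrMr//; apply: sup_upper_bound; first exact: right_slope_sup cF.
  by exists (b - a) => //; rewrite subrKC.
rewrite -ler_pdivlMr//; apply: ge_sup; first by case: (right_slope_sup lb cF).
move=> _ [h /= h0 <-]; rewrite ler_pdivrMr// mulrAC ler_pdivlMr//.
have e : b + h - b = h by ring.
by have := cF a b (b + h); rewrite e; apply; lra.
Qed.

Lemma continuous_right_continuous_from lo F :
  (forall t, lo < t -> {for t, continuous F}) -> right_continuous_from lo F.
Proof.
move=> cF t lt0 e e0.
have /cvgrPdist_le /(_ _ e0) /nbhs_ballP[d /= d0 D] := cF _ lt0.
exists (d / 2) => [|x x0 xd]; first by rewrite divr_gt0.
have : `|F t - F (t + x)| <= e.
  apply: D; rewrite /ball/= opprD addrA subrr sub0r normrN gtr0_norm//.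
  by apply: le_lt_trans xd _; rewrite ltr_pdivrMr// ltr_pMr// ltr1n.
by rewrite ler_norml => /andP[h1 h2]; lra.
Qed.

(** A supremum of continuous functions is lower semicontinuous: an [h] that nearly attains it at [t]
    is kept fixed and still serves at [t + x]. *)
Lemma right_slope_right_continuous lo F : convex_slopes lo F ->
  (forall t, lo < t -> {for t, continuous F}) ->
  right_continuous_from lo (right_slope F).
Proof.
move=> cF ctF t lt0 e e0.
have [_ [h /= h0 <-] hE] := sup_adherent e0 (right_slope_sup lt0 cF).
rewrite -/(right_slope F t) in hE.
(* The slack of that [h]; each of the two values of [F] in the quotient may move by half of
   [e1 * h]. *)
set e1 := (F t - F (t + h)) / h - (right_slope F t - e).
have e10 : 0 < e1 by rewrite subr_gt0.
have eh0 : 0 < e1 * h / 2 by rewrite divr_gt0// mulr_gt0.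
have lth : lo < t + h by lra.
have /cvgrPdist_le /(_ _ eh0) /nbhs_ballP[d1 /= d10 D1] := ctF _ lt0.
have /cvgrPdist_le /(_ _ eh0) /nbhs_ballP[d2 /= d20 D2] := ctF _ lth.
exists (Num.min d1 d2 / 2) => [|x x0 xd]; first by rewrite divr_gt0// lt_min d10.
have xm : x < Num.min d1 d2.
  apply: le_lt_trans xd _; rewrite ltr_pdivrMr// ltr_pMr ?ltr1n//.
  by rewrite lt_min d10.
move: xm; rewrite lt_min => /andP[xd1 xd2].
have : `|F t - F (t + x)| <= e1 * h / 2.
  by apply: D1; rewrite /ball/= opprD addrA subrr sub0r normrN gtr0_norm.
have : `|F (t + h) - F (t + h + x)| <= e1 * h / 2.
  by apply: D2; rewrite /ball/= opprD addrA subrr sub0r normrN gtr0_norm.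
rewrite !ler_norml => /andP[h1 h2] /andP[h3 h4].
apply: le_trans (_ : (F (t + x) - F (t + x + h)) / h <= _); last first.
  apply: sup_upper_bound; last by exists h.
  by apply: right_slope_sup cF; lra.
rewrite ler_pdivlMr//.
have : e1 * h = F t - F (t + h) - (right_slope F t - e) * h.
  by rewrite /e1 mulrBl divfK// gt_eqF.
rewrite [t + x + h]addrAC; lra.
Qed.

End right_slope.

Section psi_tower.
Context {R : realType} (d : nat) (psi : R -> R).
Hypotheses (d2 : (2 <= d)%N) (gen : generator psi) (strict : strict_generator psi)
  (dmon : d_monotone d psi).

Lemma strict_generator_gt0 z : 0 <= z -> 0 < psi z.
Proof.
move=> z0; have /andP[p0 _] := gen_range gen z0.
rewrite lt_neqAle p0 andbT; apply/eqP => pz.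
have : (gen_pinv psi 0 <= z%:E)%E by apply: ereal_inf_lbound; exists z.
by rewrite strict leye_eq.
Qed.

Lemma generator_small e : 0 < e -> exists2 t, 0 < t & psi t < e.
Proof.
move=> e0; have /cvgrPdist_lt /(_ _ e0) H := gen_lim gen.
have : \forall t \near +oo, 0 < t /\ `|0 - psi t| < e.
  by near=> t; split; near: t => //; exact: nbhs_pinfty_gt.
move=> /filter_ex[t [t0]]; rewrite sub0r normrN => h; exists t => //.
exact: le_lt_trans (ler_norm _) h.
Unshelve. all: by end_near. Qed.

Definition psi_tower (k : nat) : R -> R :=
  let f k t := (-1) ^+ k * derive1n k psi t in
  if (k <= d - 2)%N then f k else right_slope (f (d - 2)%N).

Lemma psi_towerE k t : (k <= d - 2)%N ->
  psi_tower k t = (-1) ^+ k * derive1n k psi t.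
Proof. by rewrite /psi_tower => ->. Qed.

Let psi_tower_derive k (t : R) : (k < d - 2)%N -> 0 < t ->
  is_derive t 1 (psi_tower k) (- psi_tower k.+1 t).
Proof.
move=> kd t0; rewrite psi_towerE//.
have -> : psi_tower k = (fun t => (-1) ^+ k * derive1n k psi t).
  by apply/funext => u; rewrite psi_towerE// ltnW.
have H : is_derive t 1 (derive1n k psi) (derive1n k.+1 psi t).
  rewrite derive1nS derive1E; apply: DeriveDef => //; exact: (dmon_derivable dmon).
apply: (is_derive_eq (is_deriveZ ((-1) ^+ k) H)).
by rewrite exprS mulN1r mulNr opprK.
Qed.

Let psi_tower_ge0 k (t : R) : (k <= d - 2)%N -> 0 < t -> 0 <= psi_tower k t.
Proof. by move=> kd t0; rewrite psi_towerE//; exact: (dmon_sign dmon). Qed.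

Let psi_tower_mean k (a b : R) : (k < d - 2)%N -> 0 < a -> a <= b ->
  exists2 c, a <= c <= b & psi_tower k a - psi_tower k b = psi_tower k.+1 c * (b - a).
Proof.
move=> kd a0 ab.
have [|x||c cab E] := @MVT_segment R (psi_tower k) (fun x => - psi_tower k.+1 x) a b.
- exact: ab.
- by rewrite in_itv/= => /andP[ax _]; apply: psi_tower_derive => //; exact: lt_trans ax.
- apply: derivable_within_continuous => x; rewrite in_itv/= => /andP[ax _].
  by have [] := psi_tower_derive kd (lt_le_trans a0 ax).
- by exists c; [rewrite in_itv in cab|rewrite -opprB E mulNr opprK].
Qed.

Let psi_tower_noninc k (a b : R) : (k <= d - 2)%N -> 0 < a -> a <= b ->
  psi_tower k b <= psi_tower k a.
Proof.
rewrite leq_eqVlt => /predU1P[->|kd] a0 ab.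
  by rewrite !psi_towerE//; exact: (dmon_noninc dmon).
have [c /andP[ac _] E] := psi_tower_mean kd a0 ab.
rewrite -subr_ge0 E mulr_ge0 ?subr_ge0//; apply: psi_tower_ge0 => //.
exact: lt_le_trans ac.
Qed.

Let convex_top : convex_slopes 0 (psi_tower (d - 2)).
Proof.
have -> : psi_tower (d - 2) = (fun t => (-1) ^+ (d - 2) * derive1n (d - 2) psi t).
  by apply/funext => u; rewrite psi_towerE.
exact/convex_function_slopes/(dmon_convex dmon).
Qed.

Let psi_tower_top k : ~~ (k <= d - 2)%N ->
  psi_tower k = right_slope (psi_tower (d - 2)).
Proof. by move=> kd; rewrite /psi_tower (negbTE kd) leqnn. Qed.

Let psi_tower_slope k : (k < d.-1)%N ->
  slope_between 0 (psi_tower k) (psi_tower k.+1).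
Proof.
move=> kd; have [kd2|kd2] := ltnP k (d - 2); last first.
  rewrite [psi_tower k.+1]psi_tower_top -?ltnNge//.
  have -> : k = (d - 2)%N by apply/eqP; lia.
  exact/right_slope_between/convex_top.
move=> a b a0 ab; have [c /andP[ac cb] ->] := psi_tower_mean kd2 a0 ab.
have c0 := lt_le_trans a0 ac.
by rewrite !ler_wpM2r ?subr_ge0//; exact: psi_tower_noninc.
Qed.

Let psi_tower_ge0_top k (t : R) : (k <= d.-1)%N -> 0 < t -> 0 <= psi_tower k t.
Proof.
move=> kd t0; have [kd2|kd2] := leqP k (d - 2); first exact: psi_tower_ge0.
have -> : k = (d - 2).+1 by apply/eqP; lia.
have t1 : t <= t + 1 by lra.
have := @psi_tower_slope (d - 2)%N ltac:(lia) t (t + 1) t0 t1.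
have := psi_tower_noninc (leqnn _) t0 t1.
lra.
Qed.

(** The sign conditions give only [0 <=]. A strict [psi] is positive and tends to 0, and the
    induction carries this pair of properties up the tower. *)
Let psi_tower_gt0 k : (k <= d.-1)%N ->
  (forall t, 0 < t -> 0 < psi_tower k t) /\
  (forall e, 0 < e -> exists2 t, 0 < t & psi_tower k t < e).
Proof.
elim: k => [_|k IH kd].
  split=> [t t0|e e0].
    by rewrite psi_towerE// expr0 mul1r; exact/strict_generator_gt0/ltW.
  by have [t t0 te] := generator_small e0; exists t => //; rewrite psi_towerE// expr0 mul1r.
have [h1 h2] := IH (ltnW kd).
apply: slope_between_gt0 (psi_tower_slope kd) _ h1 h2.
by move=> t t0; exact: psi_tower_ge0_top.
Qed.

Lemma psi_tower_small k e : (k <= d.-1)%N -> 0 < e ->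
  exists2 t, 0 < t & psi_tower k t < e.
Proof. by move=> kd e0; have [_ h] := psi_tower_gt0 kd; exact: h. Qed.

Lemma tower_psi_tower : tower 0 d.-1 psi_tower.
Proof.
split=> [k kd t t0||k t kd t0]; last by have [h _] := psi_tower_gt0 kd; exact: h.
- by apply: psi_tower_derive => //; lia.
- exact: psi_tower_slope.
Qed.

Lemma psi_tower_continuous k (t : R) : (k < d.-1)%N -> 0 < t -> {for t, continuous (psi_tower k)}.
Proof.
move=> kd t0; apply: (slope_between_continuous (psi_tower_slope kd) t0) => x x0.
exact: psi_tower_ge0_top.
Qed.

Lemma psi_tower_right_continuous k : (k <= d.-1)%N -> right_continuous_from 0 (psi_tower k).
Proof.
move=> kd; have [kd2|kd2] := leqP k (d - 2).
  by apply: continuous_right_continuous_from => t t0; apply: psi_tower_continuous => //; lia.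
rewrite psi_tower_top -?ltnNge//; apply: right_slope_right_continuous => //.
by move=> t t0; apply: psi_tower_continuous => //; lia.
Qed.

End psi_tower.

(** * Probabilities of boxes *)

Lemma probability_setI_full dT (T : measurableType dT) (R : realType)
    (P : probability T R) (A B : set T) :
  measurable A -> measurable B -> P B = 1%E -> P (A `&` B) = P A.
Proof.
move=> mA mB PB; apply/eqP; rewrite eq_le; apply/andP; split.
  by apply: le_measure; rewrite ?inE//; exact: measurableI.
have PC : P (~` B) = 0%E by rewrite probability_setC// PB subee.
have := @measureU2 _ _ _ P (A `&` B) (~` B) (measurableI _ _ mA mB) (measurableC mB).
rewrite [X in (_ <= X)%E](_ : _ = P (A `&` B)); last by rewrite /= PC adde0.
apply: le_trans; apply: le_measure; rewrite ?inE//.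
  by apply: measurableU; [exact: measurableI|exact: measurableC].
by move=> w Aw; have [Bw|Bw] := pselect (B w); [left|right].
Qed.

Lemma probability_cover_le dT (T : measurableType dT) (R : realType)
    (P : probability T R) (I : eqType) (B : I -> set T) (c : R) (s : seq I) (A : set T) :
  measurable A -> (forall j, measurable (B j)) -> (forall j, (P (B j) <= c%:E)%E) ->
  (forall w, A w -> exists2 j, j \in s & B j w) ->
  (P A <= ((size s)%:R * c)%:E)%E.
Proof.
move=> + mB PB; elim: s A => [|j s IH] A mA AB.
  rewrite (_ : A = set0) ?measure0 ?mul0r//.
  by apply/seteqP; split => w // /AB[].
have mAB : measurable (A `\` B j) by exact: measurableD.
apply: (@le_trans _ _ (P (B j `|` (A `\` B j)))).
  apply: le_measure; rewrite ?inE//; first exact: measurableU.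
  by move=> w Aw; have [Bw|Bw] := pselect (B j w); [left|right].
apply: le_trans (@measureU2 _ _ _ P (B j) (A `\` B j) (mB j) mAB) _ => /=.
rewrite -natr1 mulrDl mul1r addrC EFinD leeD//; apply: IH => // w [Aw Bw].
by have [j'] := AB w Aw; rewrite inE => /orP[/eqP->//|]; exists j'.
Qed.

Section survival.
Context {R : realType} dT (T : measurableType dT) (P : probability T R) (k : nat)
  (X : T -> k.-tuple R) (G : R -> R).
Hypotheses (mX : measurable_fun setT X)
  (G_noninc : forall a b : R, 0 <= a -> a <= b -> G b <= G a) (G0 : G 0 = 1)
  (survivalX : forall z : 'I_k -> R, (forall i, 0 <= z i) ->
    P [set w | forall i, tnth (X w) i <= G (z i)] = (G (\sum_i z i))%:E).

Let mXi i : measurable_fun setT (fun w => tnth (X w) i).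
Proof. by have /(_ mX) := (measurable_fun_tnthP X).1; exact. Qed.

Lemma measurable_coord_le i (c : R) : measurable [set w | tnth (X w) i <= c].
Proof.
have := mXi i measurableT (measurable_itv `]-oo, c]).
by rewrite setTI; congr measurable; apply/seteqP; split => w /=; rewrite in_itv.
Qed.

Lemma measurable_coord_gt i (c : R) : measurable [set w | c < tnth (X w) i].
Proof.
have := mXi i measurableT (measurable_itv `]c, +oo[).
by rewrite setTI; congr measurable; apply/seteqP; split => w /=; rewrite in_itv/= andbT.
Qed.

Let orthant (c : 'I_k -> R) := [set w | forall i, tnth (X w) i <= c i].

Let measurable_orthant c : measurable (orthant c).
Proof.
rewrite (_ : orthant c = \bigcap_(i in setT) [set w | tnth (X w) i <= c i]).
  by apply: fin_bigcap_measurable => // i _; exact: measurable_coord_le.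
by apply/seteqP; split => [w h i _|w h i]; exact: h.
Qed.

Let box z b (js : seq 'I_k) :=
  orthant (G \o z) `&` [set w | forall j, j \in js -> G (b j) < tnth (X w) j].

Let measurable_box z b js : measurable (box z b js).
Proof.
apply: measurableI; first exact: measurable_orthant.
rewrite (_ : [set w | _] =
    \bigcap_(j in [set j | j \in js]) [set w | G (b j) < tnth (X w) j])//.
by apply: fin_bigcap_measurable => // i _; exact: measurable_coord_gt.
Qed.

(** As [G] decreases, [tnth (X w) j <= G (z j)] reads [z j <= Z_j]. Imposing [Z_j < b j] removes the
    box with [z j] raised to [b j], which is one more difference. *)
Let box_prob (z b : 'I_k -> R) (js : seq 'I_k) : uniq js ->
  (forall i, 0 <= z i) -> (forall j, j \in js -> z j <= b j) ->
  P (box z b js) = (iter_diff [seq b j - z j | j <- js] G (\sum_i z i))%:E.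
Proof.
elim: js z => [|j js IH] z.
  move=> _ z0 _; rewrite /= -survivalX//; congr (P _); apply/seteqP.
  by split => w; [case|split].
move=> /= /andP[jjs ujs] z0 zb.
pose z' i := if i == j then b j else z i.
have zbj : z j <= b j by apply: zb; rewrite inE eqxx.
have zz' i : z i <= z' i by rewrite /z'; case: eqP => [->|].
have z'0 i : 0 <= z' i by exact: le_trans (zz' i).
have zjs i : i \in js -> z' i = z i.
  by rewrite /z'; case: eqP => [->|//]; rewrite (negbTE jjs).
have zb' i : i \in js -> z i <= b i by move=> ijs; apply: zb; rewrite inE ijs orbT.
have sub : box z' b js `<=` box z b js.
  move=> w [h1 h2]; split => // i; apply: le_trans (h1 i) _ => /=.
  exact: G_noninc.
have -> : box z b (j :: js) = box z b js `\` box z' b js.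
  apply/seteqP; split => w.
    move=> [h1 h2]; split.
      by split => // i ijs; apply: h2; rewrite inE ijs orbT.
    move=> [h3 _]; have := h2 j; rewrite inE eqxx => /(_ isT).
    by rewrite ltNge; have := h3 j; rewrite /= /z' eqxx => ->.
  move=> [[h1 h2] h3]; split => // i; rewrite inE => /orP[/eqP->{i}|]; last exact: h2.
  rewrite ltNge; apply/negP => h4; apply: h3; split => // i /=.
  by rewrite /z'; case: eqP => [->//|_]; exact: h1.
transitivity (P (box z b js) - P (box z' b js))%E.
  rewrite -[X in (_ - P X)%E](setIidr sub); apply: measureD => //.
  by rewrite ltey_eq fin_num_measure.
rewrite (IH z ujs z0 zb') (IH z' ujs z'0); last first.
  by move=> i ijs; rewrite zjs//; exact: zb'.
rewrite -EFinB; congr ((iter_diff _ G _ - iter_diff _ G _)%:E).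
  by apply/eq_in_map => i ijs; rewrite zjs.
rewrite (bigD1 j)//= [in RHS](bigD1 j)//= /z' eqxx.
rewrite (eq_bigr z) => [|i /negbTE -> //]; ring.
Qed.

Variables (J : {set 'I_k}) (i : 'I_k).
Hypothesis iJ : i \notin J.

(** The box [a j <= Z_j < b j], half-open so that cutting a side splits it into disjoint cells. *)
Definition cell (a b : 'I_k -> R) := [set w | forall j, j \in J ->
  G (b j) < tnth (X w) j <= G (a j)].

Definition slab (y : R) := [set w | tnth (X w) i <= G y].

Lemma measurable_cell a b : measurable (cell a b).
Proof.
rewrite (_ : cell a b = \bigcap_(j in [set j | j \in J])
    ([set w | G (b j) < tnth (X w) j] `&` [set w | tnth (X w) j <= G (a j)])).
  apply: fin_bigcap_measurable => // j _.
  by apply: measurableI; [exact: measurable_coord_gt|exact: measurable_coord_le].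
by apply/seteqP; split => w h j /h/andP.
Qed.

Lemma measurable_slab y : measurable (slab y).
Proof. exact: measurable_coord_le. Qed.

Lemma survival_le1 : P [set w | forall j, tnth (X w) j <= 1] = 1%E.
Proof.
have := survivalX (z := fun=> 0) (fun=> lexx _).
by rewrite big1// G0 => <-.
Qed.

Lemma cell_prob a b y : (forall j, 0 <= a j <= b j) -> 0 <= y ->
  P (cell a b `&` slab y) =
  (iter_diff [seq b j - a j | j <- enum J] G (\sum_(j in J) a j + y))%:E.
Proof.
move=> ab y0; pose z j := if j \in J then a j else if j == i then y else 0.
have a0 j : 0 <= a j by case/andP: (ab j).
have z0 j : 0 <= z j by rewrite /z; case: ifP => // _; case: ifP.
(* Coordinates other than [i] and those in [J] sit at level [G 0 = 1], so their constraint in [box]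
   holds almost surely. *)
rewrite -(@probability_setI_full _ _ _ P _ [set w | forall j, tnth (X w) j <= 1]).
- transitivity (P (box z b (enum J))).
    congr (P _); apply/seteqP; split => w.
      move=> [[h1 h2] h3]; split => j /=; last by rewrite mem_enum => /h1 /andP[].
      by rewrite /z; case: ifPn => [/h1/andP[]//|_]; case: eqP => [->//|_]; rewrite G0.
    move=> [h1 h2]; split; last by move=> j; apply: le_trans (h1 j) _; rewrite /= -G0 G_noninc.
    split.
      move=> j jJ; rewrite h2 ?mem_enum//=; have := h1 j.
      by rewrite /= /z jJ.
    by have := h1 i; rewrite /slab /= /z (negbTE iJ) eqxx.
  rewrite box_prob ?enum_uniq//; last first.
    by move=> j; rewrite mem_enum /z => ->; case/andP: (ab j).
  congr ((iter_diff _ G _)%:E).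
    by apply/eq_in_map => j; rewrite mem_enum /z => ->.
  rewrite (bigID (mem J))/=; congr (_ + _).
    by apply: eq_bigr => j; rewrite /z => ->.
  rewrite (bigD1 i)//= big1 ?addr0 /z ?(negbTE iJ) ?eqxx//.
  by move=> j /andP[/negbTE -> /negbTE ->].
- by apply: measurableI; [exact: measurable_cell|exact: measurable_slab].
- exact: measurable_orthant.
- exact: survival_le1.
Qed.

(** At [y = 0] the slab is almost sure, so the same bounds serve for the cell alone and for its
    intersection with the event on [X_i]. *)
Lemma cell_prob_bound lo n f a b y : tower lo n f -> f 0%N = G -> (#|J| <= n)%N ->
  (forall j, 0 <= a j <= b j) -> 0 <= y -> lo < \sum_(j in J) a j + y ->
  exists2 p : R, P (cell a b `&` slab y) = p%:E &
    f #|J| (\sum_(j in J) b j + y) * \prod_(j in J) (b j - a j) <= p <=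
    f #|J| (\sum_(j in J) a j + y) * \prod_(j in J) (b j - a j).
Proof.
move=> tw fG Jn ab y0 lot; eexists; first exact: cell_prob.
set s := [seq _ | _ <- _].
have sJ : size s = #|J| by rewrite size_map cardE.
have s0 : all (>= 0) s.
  by apply/allP => _ /mapP[j _ ->]; rewrite subr_ge0; case/andP: (ab j).
have := iter_diff_bound tw (s := s); rewrite sJ fG => /(_ _ Jn s0 lot).
rewrite !big_map !big_enum/=.
by rewrite [X in _ X * _]addrAC -big_split/= (eq_bigr b) => [//|j _]; rewrite subrKC.
Qed.

Lemma coord_prob j (N : R) : 0 <= N ->
  P [set w | tnth (X w) j <= G N] = (G N)%:E.
Proof.
move=> N0; pose z j' := if j' == j then N else 0.
have z0 j' : 0 <= z j' by rewrite /z; case: ifP.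
have := survivalX z0; rewrite (bigD1 j)//= big1 ?addr0; last first.
  by move=> j' /negbTE; rewrite /z => ->.
rewrite {2}/z eqxx => <-.
rewrite -(@probability_setI_full _ _ _ P _ [set w | forall j, tnth (X w) j <= 1]).
- congr (P _); apply/seteqP; split => w.
    by move=> [h1 h2] j'; rewrite /z; case: eqP => [->//|_]; rewrite G0.
  move=> h; split; first by have := h j; rewrite /z eqxx.
  by move=> j'; rewrite -G0; apply: le_trans (h j') _; exact: G_noninc.
- exact: measurable_coord_le.
- exact: measurable_orthant.
- exact: survival_le1.
Qed.

Lemma probability_setI_slab0 A : measurable A -> P (A `&` slab 0) = P A.
Proof.
move=> mA; apply: probability_setI_full => //; first exact: measurable_slab.
apply/eqP; rewrite eq_le probability_le1; last exact: measurable_slab.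
rewrite -survival_le1; apply: le_measure; rewrite ?inE//.
- exact: measurable_orthant.
- exact: measurable_slab.
- by move=> w /(_ i); rewrite /slab /= G0.
Qed.

End survival.

(** * Log-convexity from conditional monotonicity *)

Section stoch_increasing_survival.
Context {R : realType} dT (T : measurableType dT) (P : probability T R) (k : nat)
  (X : T -> k.-tuple R) (n : nat) (f : nat -> R -> R).
Hypotheses (mX : measurable_fun setT X)
  (f_noninc : forall a b : R, 0 <= a -> a <= b -> f 0%N b <= f 0%N a) (f0 : f 0%N 0 = 1)
  (survivalX : forall z : 'I_k -> R, (forall i, 0 <= z i) ->
    P [set w | forall i, tnth (X w) i <= f 0%N (z i)] = (f 0%N (\sum_i z i))%:E)
  (tw : tower 0 n f).
Variables (J : {set 'I_k}) (i : 'I_k).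
Hypotheses (iJ : i \notin J) (Jn : (#|J| <= n)%N) (J0 : (0 < #|J|)%N)
  (Xinc : stoch_increasing P (fun w => tnth (X w) i) (fun w => subvec J (X w))).

Lemma measurable_subvec : measurable_fun setT (fun w => subvec J (X w)).
Proof.
apply/measurable_fun_tnthP => j; rewrite (_ : _ \o _ = fun w => tnth (X w) (enum_val j)).
  exact: (measurable_fun_tnthP X).1.
by apply/funext => w /=; rewrite tnth_mktuple.
Qed.

Let cellE a b : cell X (f 0%N) J a b = (fun w => subvec J (X w)) @^-1`
  [set v | forall j, f 0%N (b (enum_val j)) < tnth v j <= f 0%N (a (enum_val j))].
Proof.
apply/seteqP; split => w h.
  by move=> j; rewrite tnth_mktuple; apply: h; exact: enum_valP.
move=> j jJ; have := h (enum_rank_in jJ j).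
by rewrite tnth_mktuple enum_rankK_in.
Qed.

Let measurable_boxJ (a b : R) :
  measurable [set v : #|J|.-tuple R | forall j, a < tnth v j <= b].
Proof.
rewrite (_ : [set v | _] = \bigcap_(j in [set: 'I_#|J|])
    ((fun v => tnth v j) @^-1` `]a, b])).
  apply: fin_bigcap_measurable => // j _.
  rewrite -[X in measurable X]setTI; exact: measurable_tnth.
by apply/seteqP; split => w h j; [move=> _ /=; rewrite in_itv/=; exact: h|
  have := h j I; rewrite /= in_itv].
Qed.

(** Monotonicity is used in integrated form: on the cell near [t] the conditional probability is at
    most [K], on the one near [t'] at least [K]. This gives [p * q' <= p' * q], free of [K], and the
    volumes cancel. *)
Lemma stoch_increasing_shifted (t t' y x : R) : 0 < t -> 0 < x -> t + x <= t' -> 0 <= y ->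
  f #|J| (t + x + y) * f #|J| (t' + x) <= f #|J| (t' + y) * f #|J| t.
Proof.
move=> t0 x0 txt' y0; have [kappa kappaP kappa_dec] := Xinc.
have m0 : (0 : R) < #|J|%:R by rewrite ltr0n.
(* Both cells are cubes on the diagonal whose lower corners have coordinate sums [t] and [t'] and
   whose sides add up to [x]. *)
pose a := t / #|J|%:R; pose h := x / #|J|%:R; pose a' := t' / #|J|%:R.
have h0 : 0 < h by rewrite divr_gt0.
have a0 : 0 < a by rewrite divr_gt0.
have aa' : a + h <= a' by rewrite -mulrDl ler_pM2r// invr_gt0.
have tJ : \sum_(j in J) a = t by rewrite sumr_const -mulr_natr divfK// gt_eqF.
have t'J : \sum_(j in J) a' = t' by rewrite sumr_const -mulr_natr divfK// gt_eqF.
have xJ : \sum_(j in J) h = x by rewrite sumr_const -mulr_natr divfK// gt_eqF.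
(* [s0] separates the cells: by [a + h <= a'] the points of the first lie above it and those of the
   second below. *)
pose s0 : #|J|.-tuple R := [tuple f 0%N (a + h) | j < #|J|].
have fy : 0 <= f 0%N y <= 1.
  apply/andP; split; last by rewrite -f0 f_noninc.
  move: y0; rewrite le_eqVlt => /predU1P[<-|y0]; first by rewrite f0.
  by rewrite ltW// (tower_gt0 tw).
pose B c := [set v : #|J|.-tuple R | forall j, f 0%N (c + h) < tnth v j <= f 0%N c].
have cubeB c v : 0 < c -> B c v -> in_cube v.
  move=> c0 Bv j; have /andP[h1 h2] := Bv j.
  apply/andP; split.
    by apply: le_trans (ltW h1); rewrite ltW// (tower_gt0 tw)//; lra.
  by apply: le_trans h2 _; rewrite -f0 f_noninc// ltW.
have cube0 : in_cube s0.
  move=> j; rewrite tnth_mktuple; apply/andP; split.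
    by rewrite ltW// (tower_gt0 tw)//; lra.
  by rewrite -f0 f_noninc//; lra.
pose E := `]-oo, f 0%N y]%classic : set R.
have slabE : slab X (f 0%N) i y = (fun w => tnth (X w) i) @^-1` E.
  by apply/seteqP; split => w; rewrite /slab/E/= in_itv.
have [K KE] : exists K : R, kappa s0 E = K%:E /\ 0 <= K.
  exists (fine (kappa s0 E)); split; last exact/fine_ge0/measure_ge0.
  by rewrite fineK//; apply: finite_kernel_measure; exact: measurable_itv.
case: KE => KE K0.
pose Q c := cell X (f 0%N) J (fun=> c) (fun=> c + h).
have mQ c : measurable (Q c) by exact: measurable_cell.
have QE c : P (Q c `&` slab X (f 0%N) i y) = (\int[P]_(w in Q c) kappa (subvec J (X w)) E)%E.
  rewrite slabE /Q cellE; apply: kappaP; last exact: measurable_itv.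
  exact: measurable_boxJ.
have mk c : measurable_fun (Q c) (fun w => kappa (subvec J (X w)) E).
  apply: measurable_funTS.
  exact: (measurableT_comp (measurable_kernel kappa E (measurable_itv _)) measurable_subvec).
have intK c : (\int[P]_(w in Q c) (cst K%:E) w = K%:E * P (Q c))%E.
  by rewrite integral_cst.
have up : (P (Q a `&` slab X (f 0%N) i y) <= K%:E * P (Q a))%E.
  rewrite QE -intK; apply: ge0_le_integral => //.
  move=> w; rewrite {1}/Q cellE => Qw; rewrite /= -KE.
  apply: kappa_dec => //; first exact: cubeB Qw.
  by move=> j; rewrite [tnth s0 _]tnth_mktuple; have /andP[/ltW] := Qw j.
have dn : (K%:E * P (Q a') <= P (Q a' `&` slab X (f 0%N) i y))%E.
  rewrite QE -intK; apply: ge0_le_integral => //.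
  move=> w; rewrite {1}/Q cellE => Qw; rewrite /= -KE.
  apply: kappa_dec => //; first by apply: cubeB Qw; lra.
  move=> j; rewrite [tnth s0 _]tnth_mktuple; have /andP[_ h1] := Qw j.
  by apply: le_trans h1 _; rewrite f_noninc//; lra.
have bound c y' : 0 < c -> 0 <= y' ->
    exists2 p : R, P (Q c `&` slab X (f 0%N) i y') = p%:E &
    f #|J| (\sum_(j in J) c + x + y') * \prod_(j in J) h <= p <=
    f #|J| (\sum_(j in J) c + y') * \prod_(j in J) h.
  move=> c0 y'0.
  have [|||p pE b] := @cell_prob_bound _ _ _ P _ X _ mX f_noninc f0 survivalX _ _ iJ 0 n f
    (fun=> c) (fun=> c + h) y' tw erefl Jn.
  - by move=> j; rewrite ltW//= lerDl ltW.
  - exact: y'0.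
  - rewrite ltr_wpDr// sumr_const -mulr_natr; exact: mulr_gt0.
  - exists p => //; move: b; rewrite big_split/= xJ.
    rewrite [\prod_(_ in _) _](eq_bigr (fun=> h)) => [//|j _].
    by rewrite addrC addKr.
have [p pE /andP[p1 _]] := bound a y a0 y0.
have a'0 : 0 < a' by lra.
have [p' p'E /andP[_ p'2]] := bound a' y a'0 y0.
have [q qE /andP[_ q2]] := bound a 0 a0 (lexx _).
have [q' q'E /andP[q'1 _]] := bound a' 0 a'0 (lexx _).
rewrite !probability_setI_slab0// in qE q'E.
move: up dn; rewrite pE p'E qE q'E -!EFinM !lee_fin => up dn.
rewrite tJ in p1 q2; rewrite t'J in p'2 q'1; rewrite addr0 in q2; rewrite addr0 in q'1.
set v := \prod_(j in J) h in p1 q2 p'2 q'1.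
have v0 : 0 < v by apply: prodr_gt0.
have r0 u : 0 < u -> 0 < f #|J| u by move=> u0; rewrite (tower_gt0 tw).
have r1 := r0 (t + x + y) ltac:(lra).
have r2 := r0 (t' + x) ltac:(lra).
have r3 := r0 (t' + y) ltac:(lra).
have r4 := r0 t t0.
rewrite -(ler_pM2r (mulr_gt0 v0 v0)).
have -> : f #|J| (t + x + y) * f #|J| (t' + x) * (v * v) =
  (f #|J| (t + x + y) * v) * (f #|J| (t' + x) * v) by ring.
have -> : f #|J| (t' + y) * f #|J| t * (v * v) =
  (f #|J| (t' + y) * v) * (f #|J| t * v) by ring.
have q'0 : 0 <= q' by apply: le_trans q'1; apply: mulr_ge0; exact: ltW.
have p'0 : 0 <= p' by apply: le_trans dn; rewrite mulr_ge0.
have q0 : 0 <= q by rewrite -lee_fin -qE.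
apply: le_trans (_ : p * q' <= _).
  by apply: ler_pM => //; apply: mulr_ge0; exact: ltW.
apply: le_trans (_ : p' * q <= _); last by apply: ler_pM.
apply: le_trans (_ : (K * q) * q' <= _); first by rewrite ler_wpM2r.
by rewrite mulrAC ler_wpM2r.
Qed.

End stoch_increasing_survival.

(** * Additive box functions and generalized inverses *)

Section box_function.
Context {R : realType} (I : finType) (J : {set I}).
Implicit Types (a b : I -> R) (e : R).

Definition upd a (j : I) (m : R) := fun i => if i == j then m else a i.

Definition box_dom a b := forall j, 0 <= a j <= b j.

Variable D : (I -> R) -> (I -> R) -> R.
Hypotheses (D_split : forall a b j m, box_dom a b -> j \in J -> a j <= m <= b j ->
    D a b = D a (upd b j m) + D (upd a j m) b)
  (D_small : forall e, 0 < e -> exists2 eta : R, 0 < eta & forall a b, box_dom a b ->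
    (forall j, j \in J -> b j - a j <= eta) ->
    `|D a b| <= e * \prod_(j in J) (b j - a j)).

Let vol_split a b j m : j \in J -> \prod_(j in J) (b j - a j) =
  \prod_(i in J) (upd b j m i - a i) + \prod_(i in J) (b i - upd a j m i).
Proof.
move=> jJ; rewrite (bigD1 j)//= [X in _ = X + _](bigD1 j)//= [X in _ = _ + X](bigD1 j)//=.
rewrite /upd eqxx.
rewrite [X in _ = _ * X + _](eq_bigr (fun i => b i - a i)); last first.
  by move=> i /andP[_ /negbTE->].
rewrite [X in _ = _ + _ * X](eq_bigr (fun i => b i - a i)); last first.
  by move=> i /andP[_ /negbTE->].
ring.
Qed.

Let box_halve (e d : R) :
  (forall a b, box_dom a b -> (forall j, j \in J -> b j - a j <= d) ->
    `|D a b| <= e * \prod_(j in J) (b j - a j)) ->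
  forall a b, box_dom a b -> (forall j, j \in J -> b j - a j <= d + d) ->
    `|D a b| <= e * \prod_(j in J) (b j - a j).
Proof.
move=> Hd.
(* [js] lists the coordinates that may still be longer than [d]; each step bisects one of them, and
   both [D] and the volume add up. *)
suff H (js : seq I) a b : box_dom a b ->
    (forall j, j \in J -> b j - a j <= d + d) ->
    (forall j, j \in J -> j \notin js -> b j - a j <= d) ->
    `|D a b| <= e * \prod_(j in J) (b j - a j).
  move=> a b ab abd; apply: (H (enum I)) => // j _.
  by rewrite mem_enum.
elim: js a b => [|j js IH] a b ab ab2 abd.
  by apply: Hd => // j jJ; apply: abd.
have [jJ|jJ] := boolP (j \in J); last first.
  apply: IH => // i iJ ijs; apply: abd => //; rewrite inE negb_or ijs andbT.
  by apply: contraNneq jJ => <-.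
pose m := (a j + b j) / 2.
have /andP[aj0 ajbj] := ab j.
have am : a j <= m by rewrite /m; lra.
have mb : m <= b j by rewrite /m; lra.
have ma2 := ab2 j jJ.
rewrite (D_split (m := m) ab jJ) ?am ?mb// (vol_split _ _ m jJ) mulrDr.
apply: le_trans (ler_normD _ _) _; apply: lerD; apply: IH.
- by move=> i; rewrite /upd; case: eqP => [->|_]; [rewrite aj0 am|exact: ab].
- move=> i iJ; rewrite /upd; case: eqP => [->|_]; [lra|exact: ab2].
- move=> i iJ ijs; rewrite /upd; case: eqP => [->|/eqP ij]; first by rewrite /m; lra.
  by apply: abd => //; rewrite inE negb_or ij.
- by move=> i; rewrite /upd; case: eqP => [->|_]; [rewrite mb (le_trans aj0)|exact: ab].
- move=> i iJ; rewrite /upd; case: eqP => [->|_]; [lra|exact: ab2].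
- move=> i iJ ijs; rewrite /upd; case: eqP => [->|/eqP ij]; first by rewrite /m; lra.
  by apply: abd => //; rewrite inE negb_or ij.
Qed.

(* [D_small] bounds [D] by an arbitrarily small multiple of the volume on small
   boxes; by [box_halve] the bound carries over to all boxes. *)
Lemma box_function_eq0 a b : box_dom a b -> D a b = 0.
Proof.
move=> ab; apply/eqP; rewrite -normr_eq0 eq_le normr_ge0 andbT.
have v0 : 0 <= \prod_(j in J) (b j - a j).
  by apply: prodr_ge0 => j _; rewrite subr_ge0; case/andP: (ab j).
apply/ler_addgt0Pr => e e0; rewrite add0r.
pose V := \prod_(j in J) (b j - a j) + 1.
have V0 : 0 < V by rewrite ltr_wpDl.
have eV0 : 0 < e / V by rewrite divr_gt0.
have [d d0 Hd] := D_small eV0.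
have key N : forall a b, box_dom a b ->
    (forall j, j \in J -> b j - a j <= d * 2 ^+ N) ->
    `|D a b| <= e / V * \prod_(j in J) (b j - a j).
  elim: N => [|N IH]; first by rewrite mulr1.
  have -> : d * 2 ^+ N.+1 = d * 2 ^+ N + d * 2 ^+ N by rewrite exprS; ring.
  exact: box_halve.
pose S := \sum_(j in J) (b j - a j).
pose N := (Num.truncn (S / d)).+1.
apply: le_trans (key N a b ab _) _.
  move=> j jJ; apply: le_trans (_ : S <= _).
    rewrite /S (bigD1 j)//= lerDl sumr_ge0// => i _.
    by rewrite subr_ge0; case/andP: (ab i).
  rewrite mulrC -ler_pdivrMr//; apply: le_trans (ltW (truncnS_gt _)) _.
  by rewrite -natrX ler_nat ltnW// ltn_expl.
by rewrite mulrAC ler_pdivrMr// ler_wpM2l ?(ltW e0)// lerDl.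
Qed.

End box_function.

Section generalized_inverse.
Context {R : realType} (h : R -> R).
Hypotheses (h_noninc : forall a b : R, 0 <= a -> a <= b -> h b <= h a)
  (h_cont : forall t : R, 0 < t -> {for t, continuous h})
  (h_small : forall e : R, 0 < e -> exists2 t, 0 <= t & h t < e).

(** The 0 outside []0, h 0]] is a default that makes the function total; inside, the set is bounded
    because [h] gets below [c]. *)
Definition ginv (c : R) : R :=
  if 0 < c <= h 0 then sup [set t | 0 <= t /\ c <= h t] else 0.

Let ginv_sup c : 0 < c <= h 0 -> has_sup [set t | 0 <= t /\ c <= h t].
Proof.
move=> /andP[c0 ch]; split; first by exists 0.
have [t t0 ht] := h_small c0; exists t => u [u0 cu].
rewrite leNgt; apply/negP => tu.
by have := lt_le_trans ht (le_trans cu (h_noninc t0 (ltW tu))); rewrite ltxx.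
Qed.

Lemma ginv_ge0 c : 0 <= ginv c.
Proof.
rewrite /ginv; case: ifPn => // hc.
by apply: sup_upper_bound; [exact: ginv_sup|case/andP: hc].
Qed.

(** Continuity makes the supremum a maximum. This equivalence takes the place of
    [h (ginv c) = c]. *)
Lemma le_ginv a c : 0 < c <= h 0 -> 0 <= a -> (a <= ginv c) = (c <= h a).
Proof.
move=> hc a0; apply/idP/idP => [|ca]; last first.
  by rewrite /ginv hc; apply: sup_upper_bound; [exact: ginv_sup|].
move: a0; rewrite le_eqVlt => /predU1P[<- _|a0]; first by case/andP: hc.
move=> ag; rewrite leNgt; apply/negP => hac; move: ag; apply/negP; rewrite -ltNge.
have e0 : 0 < c - h a by rewrite subr_gt0.
have /cvgrPdist_lt /(_ _ e0) /nbhs_ballP[d /= d0 D] := h_cont a0.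
pose x := Num.min (d / 2) (a / 2).
have x0 : 0 < x by rewrite lt_min !divr_gt0.
have [xd xa] : x <= d / 2 /\ x <= a / 2 by rewrite !ge_min !lexx orbT.
have hx : h (a - x) < c.
  have : `|h a - h (a - x)| < c - h a.
    by apply: D; rewrite /ball/= opprB addrC subrK gtr0_norm//; lra.
  by rewrite ltr_norml => /andP[+ _]; lra.
apply: le_lt_trans (_ : a - x < _); last lra.
rewrite /ginv hc; apply: ge_sup; first by case: (ginv_sup hc).
move=> t [t0 ct]; rewrite leNgt; apply/negP => axt.
have ax0 : 0 <= a - x by lra.
have := h_noninc ax0 (ltW axt); lra.
Qed.

(** The preimage of [[a, +oo[] is everything for [a <= 0] and an interval otherwise, as [ginv] does
    not increase on []0, h 0]]. *)
Lemma measurable_ginv : measurable_fun setT ginv.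
Proof.
move=> _; apply: (measurability _ (RGenCInfty.measurableE R)) => //.
move=> _ [_ [a ->] <-]; rewrite setTI.
have [a0|a0] := leP a 0.
  rewrite (_ : _ @^-1` _ = setT); first exact: measurableT.
  by apply/seteqP; split => c //= _; rewrite in_itv/= andbT (le_trans a0 (ginv_ge0 _)).
apply: is_interval_measurable => c1 c2 /=.
rewrite !in_itv/= !andbT => h1 h2 c /andP[c1c cc2].
have dom x : a <= ginv x -> 0 < x <= h 0.
  by rewrite {1}/ginv; case: ifPn => // _; rewrite leNgt a0.
have /andP[c10 _] := dom _ h1; have /andP[_ c2h] := dom _ h2.
rewrite in_itv/= andbT le_ginv ?(ltW a0)//; last first.
  by rewrite (lt_le_trans c10)// (le_trans cc2).
by apply: le_trans cc2 _; rewrite -le_ginv ?(ltW a0)// dom.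
Qed.

End generalized_inverse.

(** * The conditional distribution function *)

(** Required of [f 0], whose inverse recovers [Z] from [X], and of [f #|J|], whose inverse gives the
    conditional quantiles. *)
Record survival_function {R : realType} (h : R -> R) : Prop := SurvivalFunction {
  surv_noninc : forall a b : R, 0 <= a -> a <= b -> h b <= h a;
  surv_cont : forall t : R, 0 < t -> {for t, continuous h};
  surv_gt0 : forall t : R, 0 <= t -> 0 < h t;
  surv_small : forall e : R, 0 < e -> exists2 t, 0 <= t & h t < e }.

Section conditional_distribution_function.
Context {R : realType} dT (T : measurableType dT) (P : probability T R) (k : nat)
  (X : T -> k.-tuple R) (lo : R) (n : nat) (f : nat -> R -> R).
Variables (J : {set 'I_k}) (i : 'I_k).
Let r := f #|J|.
Hypotheses (mX : measurable_fun setT X) (lo0 : lo < 0) (tw : tower lo n f)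
  (f0 : f 0%N 0 = 1) (surv_f : survival_function (f 0%N)) (surv_r : survival_function r)
  (survivalX : forall z : 'I_k -> R, (forall i, 0 <= z i) ->
    P [set w | forall i, tnth (X w) i <= f 0%N (z i)] = (f 0%N (\sum_i z i))%:E)
  (iJ : i \notin J) (Jn : (#|J| <= n)%N)
  (r_lc : log_convex_from lo r)
  (r_mod : forall e : R, 0 < e -> exists2 d : R, 0 < d & forall a b, 0 <= a -> a <= b ->
    b <= a + d -> r a - r b <= e).
Let G := f 0%N.
Let phi := ginv G.

Definition surv_sum w := \sum_(j in J) phi (tnth (X w) j).

Definition surv_ratio (y t : R) := r (t + y) / r t.

Let mXi j : measurable_fun setT (fun w => tnth (X w) j).
Proof. by have /(_ mX) := (measurable_fun_tnthP X).1; exact. Qed.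

Lemma measurable_surv_sum : measurable_fun setT surv_sum.
Proof.
have -> : surv_sum = (fun w => \sum_(j <- enum J) phi (tnth (X w) j)).
  by apply/funext => w; rewrite /surv_sum big_enum.
apply: measurable_sum => j; apply: measurableT_comp (mXi j).
case: surv_f => *; exact: measurable_ginv.
Qed.

Lemma surv_sum_ge0 w : 0 <= surv_sum w.
Proof. by apply: sumr_ge0 => j _; case: surv_f => *; exact: ginv_ge0. Qed.

(** Clipping at 0 yields a monotone, hence measurable, function on the whole line that agrees with
    [r] at the values of [surv_sum]. *)
Let rmax t := r (Num.max 0 t).

Let measurable_rmax : measurable_fun setT rmax.
Proof.
apply: nonincreasing_measurable => // s t st.
apply: (surv_noninc surv_r); first by rewrite le_max lexx.
by rewrite ge_max !le_max lexx st !orbT.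
Qed.

Let r_gt0 t : 0 <= t -> 0 < r t. Proof. exact: surv_gt0. Qed.

Let rmaxE t : 0 <= t -> rmax t = r t.
Proof. by move=> t0; rewrite /rmax max_r. Qed.

Lemma surv_ratio_ge0 y t : 0 <= t -> 0 <= y -> 0 <= surv_ratio y t.
Proof. by move=> t0 y0; rewrite divr_ge0// ltW// r_gt0// addr_ge0. Qed.

Lemma surv_ratio_le1 y t : 0 <= t -> 0 <= y -> surv_ratio y t <= 1.
Proof.
move=> t0 y0; rewrite ler_pdivrMr ?r_gt0// mul1r.
by apply: (surv_noninc surv_r) => //; rewrite lerDl.
Qed.

Lemma surv_ratio_nondec y t t' : 0 <= y -> 0 <= t -> t <= t' ->
  surv_ratio y t <= surv_ratio y t'.
Proof.
move=> y0 t0 tt'; rewrite ler_pdivrMr ?r_gt0// mulrAC ler_pdivlMr; last first.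
  by rewrite r_gt0// (le_trans t0).
by apply: r_lc => //; exact: lt_le_trans t0.
Qed.

Variable y : R.
Hypothesis y0 : 0 <= y.

Let rho w := surv_ratio y (surv_sum w).

Lemma measurable_surv_ratio A : measurable_fun A (EFin \o rho).
Proof.
apply: measurable_funTS; apply/measurable_EFinP.
have -> : rho = (fun w => rmax (surv_sum w + y) * (rmax (surv_sum w))^-1).
  by apply/funext => w; rewrite !rmaxE ?addr_ge0 ?surv_sum_ge0.
apply: measurable_funM.
  apply: measurableT_comp => //; apply: measurable_funD => //.
  exact: measurable_surv_sum.
apply: (@measurableT_comp _ _ _ _ _ _ (fun t : R => (rmax t)^-1)); last exact: measurable_surv_sum.
apply: nondecreasing_measurable => // s t st.
rewrite lef_pV2 ?posrE ?r_gt0 ?le_max ?lexx//.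
apply: (surv_noninc surv_r); first by rewrite le_max lexx.
by rewrite ge_max !le_max lexx st !orbT.
Qed.

Let measurable_rho A : measurable_fun A (EFin \o rho).
Proof. exact: measurable_surv_ratio. Qed.

Let rho_ge0 w : 0 <= rho w.
Proof. by rewrite surv_ratio_ge0// surv_sum_ge0. Qed.

Let rho_le1 w : rho w <= 1.
Proof. by rewrite surv_ratio_le1// surv_sum_ge0. Qed.

Let integral_rho_bound A (c1 c2 : R) : measurable A -> 0 <= c1 ->
  (forall w, A w -> c1 <= rho w <= c2) ->
  (c1%:E * P A <= \int[P]_(w in A) (rho w)%:E <= c2%:E * P A)%E.
Proof.
move=> mA c10 H; rewrite -!integral_cst//; apply/andP; split.
  by apply: ge0_le_integral => //= w Aw; rewrite lee_fin; case/andP: (H w Aw).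
apply: ge0_le_integral => //= w Aw.
- by rewrite lee_fin.
- by rewrite lee_fin; case/andP: (H w Aw).
Qed.

(** The two sides of the identity to be proved, as real-valued additive functions of the event; [D]
    will be their difference on cells. *)
Let p1 A := fine (P (A `&` slab X G i y)).
Let p2 A := fine (\int[P]_(w in A) (rho w)%:E).

Let mslab : measurable (slab X G i y).
Proof. exact: measurable_slab. Qed.

Let p1E A : measurable A -> P (A `&` slab X G i y) = (p1 A)%:E.
Proof. by move=> mA; rewrite fineK// fin_num_measure//; exact: measurableI. Qed.

Let p2E A : measurable A -> (\int[P]_(w in A) (rho w)%:E)%E = (p2 A)%:E.
Proof.
move=> mA; rewrite fineK// ge0_fin_numE; last by apply: integral_ge0 => w _; rewrite lee_fin.
have /andP[_ h] := integral_rho_bound (c2 := 1) mA (lexx 0) (fun w _ => introT andP (conj (rho_ge0 w) (rho_le1 w))).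
by apply: le_lt_trans h _; rewrite mul1e ltey_eq fin_num_measure.
Qed.

Let p1_le A : measurable A -> 0 <= p1 A <= fine (P A).
Proof.
move=> mA; apply/andP; split; first exact/fine_ge0/measure_ge0.
apply: fine_le; rewrite ?fin_num_measure//; first exact: measurableI.
by apply: le_measure; rewrite ?inE//; exact: measurableI.
Qed.

Let p2_le A : measurable A -> 0 <= p2 A <= fine (P A).
Proof.
move=> mA; apply/andP; split.
  by apply/fine_ge0/integral_ge0 => w _; rewrite lee_fin.
have /andP[_ h] := integral_rho_bound (c2 := 1) mA (lexx 0) (fun w _ => introT andP (conj (rho_ge0 w) (rho_le1 w))).
rewrite mul1e p2E// in h; rewrite -lee_fin; apply: le_trans h _.
by rewrite fineK// fin_num_measure.
Qed.

Let p1U A B : measurable A -> measurable B -> [disjoint A & B] -> p1 (A `|` B) = p1 A + p1 B.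
Proof.
move=> mA mB AB; apply: EFin_inj; rewrite EFinD -!p1E//; last exact: measurableU.
rewrite setIUl measureU//; [exact: measurableI|exact: measurableI|].
by move/disj_set2P : AB => AB; rewrite setIACA AB set0I.
Qed.

Let p2U A B : measurable A -> measurable B -> [disjoint A & B] -> p2 (A `|` B) = p2 A + p2 B.
Proof.
move=> mA mB AB; apply: EFin_inj; rewrite EFinD -!p2E//; last exact: measurableU.
by rewrite ge0_integral_setU// => w _; rewrite lee_fin.
Qed.

Let mcell a b : measurable (cell X G J a b).
Proof. exact: measurable_cell. Qed.

Let G_noninc := surv_noninc surv_f.

Let cell_surv_sum a b w : box_dom a b -> cell X G J a b w ->
  \sum_(j in J) a j <= surv_sum w <= \sum_(j in J) b j.
Proof.
move=> ab cw.
have H j : j \in J -> a j <= phi (tnth (X w) j) <= b j.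
  move=> jJ; have /andP[h1 h2] := cw j jJ.
  have /andP[aj ajb] := ab j.
  have bj := le_trans aj ajb.
  have hc : 0 < tnth (X w) j <= G 0.
    by rewrite (lt_trans _ h1) ?(surv_gt0 surv_f)// (le_trans h2)// G_noninc.
  case: surv_f => g1 g2 g3 g4.
  rewrite /phi le_ginv// h2/= leNgt; apply/negP => bphi.
  by have := ltW bphi; rewrite le_ginv// leNgt h1.
by apply/andP; split; apply: ler_sum => j jJ; case/andP: (H j jJ).
Qed.

Let D a b := p1 (cell X G J a b) - p2 (cell X G J a b).

Let D_split a b j m : box_dom a b -> j \in J -> a j <= m <= b j ->
  D a b = D a (upd b j m) + D (upd a j m) b.
Proof.
move=> ab jJ /andP[am mb].
have m0 : 0 <= m by apply: le_trans am; case/andP: (ab j).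
have dis : [disjoint cell X G J a (upd b j m) & cell X G J (upd a j m) b].
  apply/disj_set2P; rewrite -subset0 => w [h1 h2].
  have /andP[+ _] := h1 j jJ; have /andP[_] := h2 j jJ.
  by rewrite /upd eqxx leNgt => /negP.
have cE : cell X G J a b = cell X G J a (upd b j m) `|` cell X G J (upd a j m) b.
  apply/seteqP.
    split => w; last first.
      case=> h j' j'J; have := h j' j'J; rewrite /upd; case: eqP => // ->.
        by move=> /andP[h1 ->]; rewrite (le_lt_trans _ h1)// G_noninc.
      move=> /andP[-> h1]; rewrite (le_trans h1)// G_noninc//.
      by case/andP: (ab j).
    move=> h; have [hm|hm] := leP (tnth (X w) j) (G m).
      right=> j' j'J; have := h j' j'J; rewrite /upd; case: eqP => // ->.
      by case/andP => -> _.
    left=> j' j'J; have := h j' j'J; rewrite /upd; case: eqP => // ->.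
    by case/andP => _ ->; rewrite hm.
by rewrite {1}/D cE p1U// p2U// /D; ring.
Qed.

(** With [A], [B] the bounds of [surv_sum] on the box and [v] its volume, the probability lies
    between [surv_ratio y B * r B * v] and [surv_ratio y A * r A * v], the integral between
    [surv_ratio y A * r B * v] and [surv_ratio y B * r A * v]. Pairing equal ratios leaves at most
    [(r A - r B) * v]. *)
Let D_small (e : R) : 0 < e -> exists2 eta : R, 0 < eta & forall a b, box_dom a b ->
  (forall j, j \in J -> b j - a j <= eta) ->
  `|D a b| <= e * \prod_(j in J) (b j - a j).
Proof.
move=> e0; have [d d0 Hd] := r_mod e0.
(* The [#|J|] sides then add up to at most [d]; the successor avoids a division by 0 for empty
   [J]. *)
pose eta := d / #|J|.+1%:R.
exists eta; first by rewrite divr_gt0// ltr0n.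
move=> a b ab abe.
set A := \sum_(j in J) a j; set B := \sum_(j in J) b j.
set v := \prod_(j in J) (b j - a j).
have v0 : 0 <= v by apply: prodr_ge0 => j _; rewrite subr_ge0; case/andP: (ab j).
have A0 : 0 <= A by apply: sumr_ge0 => j _; case/andP: (ab j).
have AB : A <= B by apply: ler_sum => j _; case/andP: (ab j).
have B0 := le_trans A0 AB.
have BA : B <= A + d.
  have : B - A <= \sum_(j in J) eta by rewrite -sumrB; apply: ler_sum => j jJ; exact: abe.
  rewrite sumr_const -mulr_natr /eta mulrAC => h.
  have : d * #|J|%:R / #|J|.+1%:R <= d.
    by rewrite ler_pdivrMr ?ltr0n// ler_pM2l// ler_nat.
  by move=> /(le_trans h); rewrite lerBlDl.
have rAB := Hd A B A0 AB BA.
have rAB0 : r B <= r A by exact: (surv_noninc surv_r).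
have ineq y' : 0 <= y' -> exists2 p : R, P (cell X G J a b `&` slab X G i y') = p%:E &
    r (B + y') * v <= p <= r (A + y') * v.
  move=> y'0.
  have := @cell_prob_bound _ _ _ P _ X _ mX G_noninc f0 survivalX _ _ iJ lo n f a b y' tw erefl Jn.
  by apply => //; apply: lt_le_trans lo0 _; exact: addr_ge0.
have [p pE /andP[pl pu]] := ineq _ y0.
have [q qE /andP[ql qu]] := ineq 0 (lexx _).
rewrite !addr0 in ql qu.
rewrite (probability_setI_slab0 mX f0 survivalX) in qE; last exact: mcell.
have pp1 : p1 (cell X G J a b) = p by rewrite /p1 pE.
have rA := r_gt0 A0; have rB := r_gt0 B0.
have [] : surv_ratio y A * q <= p2 (cell X G J a b) /\
    p2 (cell X G J a b) <= surv_ratio y B * q.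
  have := @integral_rho_bound (cell X G J a b) (surv_ratio y A) (surv_ratio y B)
    (mcell a b) (surv_ratio_ge0 A0 y0).
  rewrite qE p2E// -!EFinM !lee_fin => /(_ _) /andP h; apply: h => w cw.
  have /andP[h1 h2] := cell_surv_sum ab cw.
  by apply/andP; split; apply: surv_ratio_nondec => //; exact: surv_sum_ge0.
set p2c := p2 _ => p2l p2u.
have RA0 := surv_ratio_ge0 A0 y0; have RA1 := surv_ratio_le1 A0 y0.
have RB0 := surv_ratio_ge0 B0 y0; have RB1 := surv_ratio_le1 B0 y0.
have EA : r (A + y) = surv_ratio y A * r A by rewrite /surv_ratio divfK// gt_eqF.
have EB : r (B + y) = surv_ratio y B * r B by rewrite /surv_ratio divfK// gt_eqF.
rewrite EA in pu; rewrite EB in pl.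
have hA : surv_ratio y A * (r B * v) <= surv_ratio y A * q by rewrite ler_wpM2l.
have hB : surv_ratio y B * q <= surv_ratio y B * (r A * v) by rewrite ler_wpM2l.
have w0 : 0 <= (r A - r B) * v by rewrite mulr_ge0// subr_ge0.
have wA : surv_ratio y A * ((r A - r B) * v) <= (r A - r B) * v by rewrite ler_piMl.
have wB : surv_ratio y B * ((r A - r B) * v) <= (r A - r B) * v by rewrite ler_piMl.
have we : (r A - r B) * v <= e * v by rewrite ler_wpM2r.
rewrite /D pp1 -/p2c ler_norml; apply/andP; split; lra.
Qed.

(** Cells are bounded, orthants are not: what the cell misses has some [Z_j >= N], an event of
    probability at most [k%:R * G N], which controls both sides there. *)
Lemma orthant_prob (a : 'I_k -> R) : (forall j, 0 <= a j) ->
  let A := [set w | forall j, j \in J -> tnth (X w) j <= f 0%N (a j)] in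
  P (A `&` slab X (f 0%N) i y) = (\int[P]_(w in A) (surv_ratio y (surv_sum w))%:E)%E.
Proof.
move=> a0 A.
have mA : measurable A.
  rewrite (_ : A = \bigcap_(j in [set j | j \in J]) [set w | tnth (X w) j <= G (a j)])//.
  by apply: fin_bigcap_measurable => // j _; exact: measurable_coord_le.
rewrite p1E// p2E//; congr (_%:E); apply/eqP; rewrite -subr_eq0 -normr_eq0 eq_le normr_ge0 andbT.
apply/ler_addgt0Pr => e e0; rewrite add0r.
have e1 : 0 < e / k.+1%:R by rewrite divr_gt0 ?ltr0n.
have [N N0 GN] := surv_small surv_f e1.
pose b j := Num.max (a j) N.
have ab : box_dom a b by move=> j; rewrite a0 le_max lexx.
pose C := cell X G J a b.
have CA : C `<=` A by move=> w h j /h/andP[].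
have mC : measurable C by exact: mcell.
have mAC : measurable (A `\` C) by exact: measurableD.
have dis : [disjoint C & A `\` C] by apply/disj_set2P; rewrite setDE setICA setICr setI0.
have AE : A = C `|` (A `\` C) by rewrite setDUK.
have : D a b = 0 by apply: (box_function_eq0 D_split D_small).
rewrite /D -/C AE p1U// p2U// => D0.
have -> : p1 C + p1 (A `\` C) - (p2 C + p2 (A `\` C)) = p1 (A `\` C) - p2 (A `\` C).
  by rewrite -[RHS]add0r -D0; ring.
have small : fine (P (A `\` C)) <= e.
  rewrite -lee_fin fineK ?fin_num_measure//.
  have cover w : (A `\` C) w -> exists2 j, j \in enum 'I_k & tnth (X w) j <= G N.
    move=> [Aw nC]; apply: contrapT => H; apply: nC => j jJ; apply/andP; split; last exact: Aw.
    rewrite ltNge; apply/negP => h; apply: H; exists j; first by rewrite mem_enum.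
    by apply: le_trans h _; apply: G_noninc; rewrite ?le_max ?lexx ?orbT.
  have := @probability_cover_le _ _ _ P _ (fun j => [set w | tnth (X w) j <= G N])
    (G N) (enum 'I_k) _ mAC _ _ cover.
  move=> /(_ (fun j => measurable_coord_le mX j _)) H.
  apply: le_trans (H _) _.
    by move=> j; rewrite (coord_prob mX G_noninc f0 survivalX).
  rewrite lee_fin size_enum_ord; apply: le_trans (_ : k%:R * (e / k.+1%:R) <= _).
    by rewrite ler_wpM2l// ltW.
  by rewrite mulrCA ler_piMr ?(ltW e0)// ler_pdivrMr ?ltr0n// mul1r ler_nat.
have := p1_le mAC; have := p2_le mAC.
rewrite ler_norml => /andP[h1 h2] /andP[h3 h4]; apply/andP; split; lra.
Qed.

End conditional_distribution_function.

(** * Kernels and laws on tuples *)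

Definition mfun_of d d' (T : measurableType d) (T' : measurableType d') (f : T -> T')
    (mf : measurable_fun setT f) : {mfun T >-> T'} :=
  HB.pack_for {mfun T >-> T'} f (isMeasurableFun.Build _ _ _ _ f mf).

Section map_kernel.
Context {R : realType} dS (S : measurableType dS) (U : probability R R) (Q : S * R -> R).
Hypothesis mQ : measurable_fun setT Q.

Let mQs s : measurable_fun setT (fun u => Q (s, u)).
Proof. exact: measurableT_comp (measurable_pair1 s). Qed.

Definition map_kernel (s : S) : {measure set R -> \bar R} :=
  distribution U (mfun_of (mQs s)).

Lemma map_kernelE s E : map_kernel s E = U [set u | E (Q (s, u))].
Proof. by []. Qed.

Let measurable_map_kernel E : measurable E -> measurable_fun setT (map_kernel ^~ E).
Proof.
move=> mE; have mQE : measurable (Q @^-1` E) by rewrite -[X in measurable X]setTI; exact: mQ.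
have := measurable_fun_xsection U mQE.
congr (measurable_fun _ _); apply/funext => s; rewrite map_kernelE /= xsectionE.
by [].
Qed.

HB.instance Definition _ := isKernel.Build _ _ _ _ _ map_kernel measurable_map_kernel.

Let map_kernel_prob s : map_kernel s setT = 1%E.
Proof. exact: probability_setT. Qed.

HB.instance Definition _ := Kernel_isProbability.Build _ _ _ _ _ map_kernel map_kernel_prob.

End map_kernel.

Section tuple_distribution_unique.
Context {R : realType} (n : nat).
Implicit Types (a : 'I_n -> R).

Let orthant a := [set v : n.-tuple R | forall i, tnth v i <= a i].

Let G := range orthant.

Let measurable_orthant a : measurable (orthant a).
Proof.
rewrite (_ : orthant a = \bigcap_(i in setT) [set v | tnth v i <= a i]).
  apply: fin_bigcap_measurable => // i _.
  have := @measurable_tnth _ R n i measurableT _ (measurable_itv `]-oo, a i]).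
  by rewrite setTI; congr measurable; apply/seteqP; split => w /=; rewrite in_itv.
by apply/seteqP; split => [w h i _|w h i]; exact: h.
Qed.

Let orthantE : measurable = <<s G >> :> set (set (n.-tuple R)).
Proof.
apply/seteqP; split; last first.
  by apply: smallest_sub; [exact: sigma_algebra_measurable|move=> _ [a _ <-]].
apply: smallest_sub; first exact: smallest_sigma_algebra.
rewrite -bigcup_seq; apply: bigcup_sub => i _ _ [Y mY <-].
suff : measurable_fun (setT : set (g_sigma_algebraType G)) (fun v => tnth (v : n.-tuple R) i).
  by move=> /(_ measurableT _ mY).
apply: (measurability _ (RGenOInfty.measurableE R)) => _ [_ [a ->] <-].
rewrite setTI -[X in measurable X]setCK; apply: measurableC.
(* A half-space [v_i <= a] is the increasing union of the orthants whose other bounds are [N]. *)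
rewrite (_ : ~` _ = \bigcup_(N : nat) orthant (fun j => if j == i then a else N%:R)).
  apply: bigcup_measurable => N _; apply: sub_sigma_algebra.
  by exists (fun j => if j == i then a else N%:R).
apply/seteqP; split => v /=; rewrite in_itv/= andbT.
  move/negP; rewrite -leNgt => va.
  pose M := \sum_j `|tnth v j|.
  exists (Num.truncn M).+1 => //= j; case: eqP => [->//|_].
  apply: le_trans (ltW (truncnS_gt _)); apply: le_trans (ler_norm _) _.
  by rewrite /M (bigD1 j)//= lerDl sumr_ge0.
by move=> [N _ /(_ i)]; rewrite eqxx leNgt => /negP.
Qed.

(** Orthants form a generating pi-system. On the full event [I], an orthant with a corner coordinate
    [<= 0] is empty and corner coordinates above 1 can be clipped to 1, which reduces to corners in
    []0, 1]]. *)
Lemma tuple_distribution_unique (m1 m2 : probability (n.-tuple R) R) :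
  let I := [set v : n.-tuple R | forall i, 0 < tnth v i <= 1] in
  m1 I = 1%E -> m2 I = 1%E ->
  (forall a, (forall i, 0 < a i <= 1) -> m1 (orthant a) = m2 (orthant a)) ->
  forall A, measurable A -> m1 A = m2 A.
Proof.
move=> I I1 I2 H.
have mI : measurable I.
  rewrite (_ : I = \bigcap_(i in setT) [set v | 0 < tnth v i <= 1]).
    apply: fin_bigcap_measurable => // i _.
    have := @measurable_tnth _ R n i measurableT _ (measurable_itv `]0, 1]).
    by rewrite setTI; congr measurable; apply/seteqP; split => w /=; rewrite in_itv.
  by apply/seteqP; split => [w h i _|w h i]; exact: h.
apply: (measure_unique G (fun N : nat => orthant (fun=> N%:R))) => //.
- move=> _ _ [a _ <-] [b _ <-]; exists (fun i => Num.min (a i) (b i)) => //.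
  apply/seteqP; split => v; first by move=> h; split => i; have := h i; rewrite le_min => /andP[].
  by move=> [h1 h2] i; rewrite le_min h1 h2.
- by move=> N; exists (fun=> N%:R).
- apply/seteqP; split => // v _; pose M := \sum_j `|tnth v j|.
  exists (Num.truncn M).+1 => //= j.
  apply: le_trans (ltW (truncnS_gt _)); apply: le_trans (ler_norm _) _.
  by rewrite /M (bigD1 j)//= lerDl sumr_ge0.
- move=> _ [a _ <-].
  have full (m : probability (n.-tuple R) R) : m I = 1%E -> m (orthant a) = m (orthant a `&` I).
    by move=> mI1; rewrite probability_setI_full.
  suff : m1 (orthant a `&` I) = m2 (orthant a `&` I) by rewrite -!full.
  have [a0|/existsNP[i /negP]] := pselect (forall i, 0 < a i); last first.
    rewrite -leNgt => ai0; rewrite (_ : _ `&` _ = set0) ?measure0//.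
    apply/seteqP; split => // v [/(_ i) h1 /(_ i) /andP[h2 _]].
    by have := lt_le_trans h2 (le_trans h1 ai0); rewrite ltxx.
  have -> : orthant a `&` I = orthant (fun i => Num.min (a i) 1) `&` I.
    apply/seteqP; split => v [h1 h2]; split => // i; have := h1 i; have /andP[_ h] := h2 i.
      by rewrite le_min h => ->.
    by rewrite le_min => /andP[].
  rewrite !probability_setI_full//; apply: H => i.
  by rewrite lt_min a0 ltr01 ge_min lexx orbT.
- by move=> N; rewrite ltey_eq fin_num_measure.
Qed.

End tuple_distribution_unique.

(** * Stochastic monotonicity from log-convexity *)

(* [uniform_prob] lives on [measurableTypeR R], whose measurable sets are those
   of [R] but whose measurable structure is not convertible to that of [R]. *)
Definition uniform01 (R : realType) : probability R R :=
  distribution (uniform_prob (@ltr01 R) : probability (measurableTypeR R) R)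
    (@mfun_of _ _ (measurableTypeR R) R idfun (@measurable_id _ _ setT)).

(** The condition omits [u = 0], where the quantile transform meets the default value of [ginv];
    []0, 1]] has full measure. *)
Lemma uniform01_le {R : realType} (E : set R) (c : R) : measurable E -> 0 <= c <= 1 ->
  (forall u, 0 < u <= 1 -> E u <-> u <= c) -> uniform01 R E = c%:E.
Proof.
have itv (c' : R) : 0 <= c' <= 1 -> uniform01 R `]0, c']%classic = c'%:E.
  move=> /andP[c0 c1]; rewrite /uniform01/= /distribution/= /pushforward/= preimage_id /uniform_prob.
  rewrite (eq_integral (cst 1%:E)).
    by rewrite integral_cst//= lebesgue_measure_itv/= lte_fin mul1e;
      move: c0; rewrite le_eqVlt => /predU1P[<-|->]; rewrite ?ltxx// oppr0 adde0.
  move=> u; rewrite inE/= in_itv/= => /andP[u0 uc].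
  by rewrite /uniform_pdf (ltW u0) (le_trans uc c1) subr0 invr1.
move=> mE c01 H.
rewrite -(@probability_setI_full _ _ _ (uniform01 R) E `]0, 1]%classic)//; last first.
  by apply: itv; rewrite ler01 lexx.
rewrite -(itv c)//; congr (uniform01 _ _); apply/seteqP; split => u; rewrite /= !in_itv/=.
  by move=> [Eu u01]; have /andP[-> _] := u01; exact/H.
move=> /andP[u0 uc]; have u01 : 0 < u <= 1 by rewrite u0 (le_trans uc)//; case/andP: c01.
by split => //; exact/H.
Qed.

Section survival_stoch_increasing.
Context {R : realType} dT (T : measurableType dT) (P : probability T R) (k : nat)
  (X : T -> k.-tuple R) (lo : R) (n : nat) (f : nat -> R -> R).
Variables (J : {set 'I_k}) (i : 'I_k).
Let r := f #|J|.
Hypotheses (mX : measurable_fun setT X) (lo0 : lo < 0) (n0 : (0 < n)%N) (tw : tower lo n f)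
  (f0 : f 0%N 0 = 1) (surv_f : survival_function (f 0%N)) (surv_r : survival_function r)
  (f_onto : forall c, 0 < c <= 1 -> exists2 z, 0 <= z & f 0%N z = c)
  (survivalX : forall z : 'I_k -> R, (forall i, 0 <= z i) ->
    P [set w | forall i, tnth (X w) i <= f 0%N (z i)] = (f 0%N (\sum_i z i))%:E)
  (iJ : i \notin J) (Jn : (#|J| <= n)%N)
  (r_lc : log_convex_from lo r)
  (r_mod : forall e : R, 0 < e -> exists2 d : R, 0 < d & forall a b, 0 <= a -> a <= b ->
    b <= a + d -> r a - r b <= e).
Let G := f 0%N.
Let phi := ginv G.
Let Z w := subvec J (X w).

Let mXi j : measurable_fun setT (fun w => tnth (X w) j).
Proof. by have /(_ mX) := (measurable_fun_tnthP X).1; exact. Qed.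

Let mZ : measurable_fun setT Z.
Proof. exact: measurable_subvec. Qed.

Let sigma (s : #|J|.-tuple R) := \sum_(j < #|J|) phi (tnth s j).

Let sigmaE w : surv_sum X f J w = sigma (Z w).
Proof.
rewrite /surv_sum big_enum_val; apply: eq_bigr => j _.
by rewrite tnth_mktuple.
Qed.

Let phi_ge0 c : 0 <= phi c.
Proof. by case: surv_f => *; exact: ginv_ge0. Qed.

Let sigma_ge0 s : 0 <= sigma s.
Proof. exact: sumr_ge0. Qed.

Let le_phi (a c : R) : 0 < c <= 1 -> 0 <= a -> (a <= phi c) = (c <= G a).
Proof. by rewrite -f0 => c01 a0; case: surv_f => *; exact: le_ginv. Qed.

Let phi_noninc (c c' : R) : 0 < c -> c <= c' -> c' <= 1 -> phi c' <= phi c.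
Proof.
move=> c0 cc' c'1.
have c01 : 0 < c <= 1 by rewrite c0 (le_trans cc').
have c'01 : 0 < c' <= 1 by rewrite c'1 (lt_le_trans c0).
by rewrite le_phi//; apply: (le_trans cc'); rewrite -le_phi.
Qed.

Let G_noninc := surv_noninc surv_f.

Let G_lt (a b : R) : 0 <= a -> a < b -> G b < G a.
Proof.
by move=> a0; apply: (tower_decreasing tw n0); exact: lt_le_trans a0.
Qed.

Let le_G (a b : R) : 0 <= a -> 0 <= b -> (G a <= G b) = (b <= a).
Proof.
move=> a0 b0; apply/idP/idP => [|ba]; last exact: G_noninc.
by apply: contraTT; rewrite -!ltNge; exact: G_lt.
Qed.

Let rmax (t : R) := r (Num.max 0 t).
Let Gmax (t : R) := G (Num.max 0 t).

Let measurable_max (h : R -> R) : survival_function h ->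
  measurable_fun setT (fun t : R => h (Num.max 0 t)).
Proof.
move=> sh; apply: nonincreasing_measurable => // s t st.
apply: (surv_noninc sh); first by rewrite le_max lexx.
by rewrite ge_max !le_max lexx st !orbT.
Qed.

Let pos (s : #|J|.-tuple R) := [forall j, 0 < tnth s j].

(* [Q (s, u)], for [u] uniform, is the quantile transform of the conditional law
   given [s]. If some coordinate of [s] vanishes, a null event, it is the Dirac
   mass at 0, which keeps the distribution functions nonincreasing in [s]. *)
Let Q (su : #|J|.-tuple R * R) : R :=
  if pos su.1 then Gmax (ginv r (su.2 * rmax (sigma su.1)) - sigma su.1) else 0.

Let measurable_sigma : measurable_fun setT sigma.
Proof.
apply: measurable_sum => j; apply: measurableT_comp; last exact: measurable_tnth.
by case: surv_f => *; exact: measurable_ginv.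
Qed.

Let measurable_pos : measurable_fun setT pos.
Proof.
apply: (measurable_fun_bool true); rewrite setTI.
rewrite (_ : _ @^-1` _ = \bigcap_(j in [set: 'I_#|J|]) ((fun s => tnth s j) @^-1` `]0, +oo[)).
  apply: fin_bigcap_measurable => // j _; rewrite -[X in measurable X]setTI.
  exact: measurable_tnth.
apply/seteqP; split => s.
  by move=> /forallP h j _; rewrite /= in_itv/= h.
by move=> h; apply/forallP => j; have := h j I; rewrite /= in_itv/= andbT.
Qed.

Let measurable_Q : measurable_fun setT Q.
Proof.
apply: measurable_fun_ifT => //=; first exact: measurableT_comp.
apply: (measurableT_comp (measurable_max surv_f)).
apply: measurable_funB; last exact: measurableT_comp.
apply: (@measurableT_comp _ _ _ _ _ _ (ginv r)).
  by case: surv_r => *; exact: measurable_ginv.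
apply: measurable_funM => //; apply: (measurableT_comp (measurable_max surv_r)).
exact: measurableT_comp.
Qed.

Let U : probability R R := uniform01 R.
Let kappa : R.-pker (#|J|.-tuple R) ~> R := map_kernel U measurable_Q.

Let kappaE s E : kappa s E = U [set u | E (Q (s, u))].
Proof. by []. Qed.

Let measurable_Qs s E : measurable E -> measurable [set u | E (Q (s, u))].
Proof.
move=> mE; rewrite -[X in measurable X]setTI.
exact: (measurableT_comp measurable_Q (measurable_pair1 s)).
Qed.

(** [Q (s, u) <= G z] unfolds to [sigma s + z <= ginv r (u * r (sigma s))], and by [le_ginv] to
    [u * r (sigma s) <= r (sigma s + z)]. *)
Let kappa_cdf s (z : R) : pos s -> 0 <= z ->
  kappa s `]-oo, G z]%classic = (surv_ratio f J z (sigma s))%:E.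
Proof.
move=> ps z0; apply: uniform01_le.
- exact: (measurable_Qs _ (measurable_itv _)).
- by rewrite (surv_ratio_ge0 surv_r)// (surv_ratio_le1 surv_r).
move=> u u01; have /andP[u0 u1] := u01.
have s0 := sigma_ge0 s.
have rs : 0 < r (sigma s) by exact: surv_gt0.
have v01 : 0 < u * r (sigma s) <= r 0.
  rewrite mulr_gt0//= (le_trans (_ : _ <= r (sigma s)))//.
    by rewrite ler_piMl// ltW.
  exact: (surv_noninc surv_r).
have le_r a : 0 <= a -> (a <= ginv r (u * r (sigma s))) = (u * r (sigma s) <= r a).
  by move=> a0; case: surv_r => *; exact: le_ginv.
(* Since [u <= 1], the argument of [Gmax] is nonnegative and the clipping has no effect. *)
have sg : sigma s <= ginv r (u * r (sigma s)) by rewrite le_r// ler_piMl// ltW.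
rewrite /= /Q/= ps in_itv/= /Gmax /rmax !max_r ?subr_ge0// le_G ?subr_ge0//.
rewrite lerBrDr le_r ?addr_ge0// addrC.
by rewrite /surv_ratio ler_pdivlMr.
Qed.

Let kappa_npos s (y : R) : ~~ pos s -> 0 <= y -> kappa s `]-oo, y]%classic = 1%E.
Proof.
move=> ps y0; rewrite -(prob_kernel (s := kappa) s) !kappaE.
by congr (U _); apply/seteqP; split => u //= _; rewrite /Q (negbTE ps) in_itv.
Qed.

(** Raising [s] lowers [sigma s] and with it the ratio, by log-convexity. *)
Let kappa_noninc (y : R) s t : 0 <= y <= 1 -> in_cube s -> in_cube t ->
  (forall j, tnth s j <= tnth t j) -> (kappa t `]-oo, y]%classic <= kappa s `]-oo, y]%classic)%E.
Proof.
move=> /andP[y0 y1] s01 t01 st.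
have [ps|ps] := boolP (pos s); last first.
  rewrite (kappa_npos ps y0) -(prob_kernel (s := kappa) t).
  by apply: le_measure; rewrite ?inE//; exact: measurable_itv.
have pt : pos t.
  by apply/forallP => j; apply: lt_le_trans (st j); move/forallP : ps.
move: y0; rewrite le_eqVlt => /predU1P[<-|y0].
  rewrite kappaE (_ : [set u | _] = set0) ?measure0//.
  apply/seteqP; split => u //=; rewrite in_itv/= /Q pt /Gmax/=.
  by rewrite leNgt (surv_gt0 surv_f)// le_max lexx.
have [z z0 <-] := f_onto (introT andP (conj y0 y1)).
rewrite !kappa_cdf// lee_fin.
apply: (surv_ratio_nondec lo0 surv_r r_lc) => //.
apply: ler_sum => j _; apply: phi_noninc => //.
  by move/forallP : ps.
by case/andP: (t01 j).
Qed.

Let Om := [set w | forall j, 0 < tnth (X w) j <= 1].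

Let mOm : measurable Om.
Proof.
rewrite (_ : Om = \bigcap_(j in setT) ([set w | 0 < tnth (X w) j] `&` [set w | tnth (X w) j <= 1])).
  apply: fin_bigcap_measurable => // j _; apply: measurableI.
    exact: measurable_coord_gt.
  exact: measurable_coord_le.
by apply/seteqP; split => w h j; [move=> _; have /andP[] := h j|
  have [/= -> ->] := h j I].
Qed.

Let P_Om : P Om = 1%E.
Proof.
have mN := measurableC mOm.
suff PN : P (~` Om) = 0%E.
  by rewrite -[Om]setCK probability_setC// PN sube0.
apply/eqP; rewrite eq_le measure_ge0 andbT; apply/lee_addgt0Pr => e e0; rewrite add0e.
have e1 : 0 < e / k.+1%:R by rewrite divr_gt0 ?ltr0n.
have [N N0 GN] := surv_small surv_f e1.
have mle1 : measurable [set w | forall j, tnth (X w) j <= 1].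
  rewrite (_ : [set w | _] = \bigcap_(j in setT) [set w | tnth (X w) j <= 1]).
    by apply: fin_bigcap_measurable => // j _; exact: measurable_coord_le.
  by apply/seteqP; split => [w h j _|w h j]; exact: h.
rewrite -(probability_setI_full mN mle1); last exact: (survival_le1 f0 survivalX).
have cover w : (~` Om `&` [set w | forall j, tnth (X w) j <= 1]) w ->
    exists2 j, j \in enum 'I_k & tnth (X w) j <= G N.
  move=> [/existsNP[j hj] h1]; exists j; first by rewrite mem_enum.
  apply: contra_notT hj; rewrite -ltNge => h; rewrite h1 andbT.
  by apply: lt_trans h; exact: (surv_gt0 surv_f).
have := @probability_cover_le _ _ _ P _ (fun j => [set w | tnth (X w) j <= G N])
  (G N) (enum 'I_k) _ (measurableI _ _ mN mle1) _ _ cover.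
move=> /(_ (fun j => measurable_coord_le mX j _)) H.
apply: le_trans (H _) _.
  by move=> j; rewrite (coord_prob mX G_noninc f0 survivalX).
rewrite lee_fin size_enum_ord; apply: le_trans (_ : k%:R * (e / k.+1%:R) <= _).
  by rewrite ler_wpM2l// ltW.
by rewrite mulrCA ler_piMr ?(ltW e0)// ler_pdivrMr ?ltr0n// mul1r ler_nat.
Qed.

Let prod_kappa (B : set (#|J|.-tuple R)) (E : set R) : measurable B -> measurable E ->
  (P \x U)%E [set wu | E (Q (Z wu.1, wu.2)) /\ B (Z wu.1)] =
  (\int[P]_(w in Z @^-1` B) kappa (Z w) E)%E.
Proof.
move=> mB mE; rewrite integral_mkcond; apply: eq_integral => w _.
rewrite patchE [LHS]/comp xsectionE; case: ifPn; rewrite ?inE ?notin_setE => BZ.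
  by rewrite kappaE; congr (uniform01 _ _); apply/seteqP; split => u /=; [case|].
rewrite (_ : _ @^-1` _ = set0) ?measure0//.
by apply/seteqP; split => u //= [].
Qed.

(** [kappa] is the conditional distribution as soon as replacing [X_i] by a fresh quantile transform
    of [Z] keeps the joint law, that is, [Y1] and [Y2] have the same distribution. *)
Let Y1 w := [tuple of tnth (X w) i :: Z w].
Let Y2 (wu : T * R) := [tuple of Q (Z wu.1, wu.2) :: Z wu.1].

Let mY1 : measurable_fun setT Y1.
Proof. exact: measurable_cons. Qed.

Let mY2 : measurable_fun setT Y2.
Proof.
apply: measurable_cons; last exact: measurableT_comp.
apply: (measurableT_comp measurable_Q); apply: measurable_fun_pair => //.
exact: measurableT_comp.
Qed.

Let tnth_cons (c : R) (v : #|J|.-tuple R) (Pr : 'I_#|J|.+1 -> R -> Prop) :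
  (forall i0, Pr i0 (tnth [tuple of c :: v] i0)) <->
  Pr ord0 c /\ forall j, Pr (lift ord0 j) (tnth v j).
Proof.
split=> [h|[h1 h2] i0].
  by split=> [|j]; [exact: (h ord0)|have := h (lift ord0 j); rewrite tnthS].
by case: (unliftP ord0 i0) => [j ->|->]; [rewrite tnthS|].
Qed.

Let Om_pos w : Om w -> pos (Z w).
Proof. by move=> h; apply/forallP => j; rewrite tnth_mktuple; have /andP[] := h (enum_val j). Qed.

Let measurable_unit_cube m : measurable [set v : m.-tuple R | forall j, 0 < tnth v j <= 1].
Proof.
rewrite (_ : [set v | _] = \bigcap_(j in setT) ((fun v : m.-tuple R => tnth v j) @^-1` `]0, 1])).
  apply: fin_bigcap_measurable => // j _; rewrite -[X in measurable X]setTI.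
  exact: measurable_tnth.
by apply/seteqP; split => v h j; [move=> _; rewrite /= in_itv; exact: h|have := h j I; rewrite /= in_itv].
Qed.

Let probability_eq1 d' (T' : measurableType d') (P' : probability T' R) (A B : set T') :
  measurable A -> measurable B -> A `<=` B -> P' A = 1%E -> P' B = 1%E.
Proof.
move=> mA mB AB PA; apply/eqP; rewrite eq_le probability_le1// -PA.
by apply: le_measure; rewrite ?inE.
Qed.

Let joint A : measurable A -> P (Y1 @^-1` A) = (P \x U)%E (Y2 @^-1` A).
Proof.
move=> mA.
suff : distribution P (mfun_of mY1) A = distribution (P \x U)%E (mfun_of mY2) A by [].
apply: tuple_distribution_unique mA => [||a a01].
- apply: (probability_eq1 mOm _ _ P_Om).
    rewrite -[X in measurable X]setTI; exact: (mY1 measurableT (@measurable_unit_cube _)).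
  move=> w Omw; apply/(tnth_cons _ _ (fun _ c => 0 < c <= 1)); split; first exact: Omw.
  by move=> j; rewrite tnth_mktuple; exact: Omw.
- apply: (@probability_eq1 _ _ (P \x U)%E (Om `*` setT)).
  + exact: measurableX.
  + rewrite -[X in measurable X]setTI; exact: (mY2 measurableT (@measurable_unit_cube _)).
  + move=> [w u] [Omw _]; apply/(tnth_cons _ _ (fun _ c => 0 < c <= 1)); split.
      rewrite /Q Om_pos//=; rewrite (surv_gt0 surv_f) ?le_max ?lexx//= -f0.
      by apply: G_noninc => //; rewrite le_max lexx.
    by move=> j; rewrite tnth_mktuple; exact: Omw.
  + transitivity (P Om * U setT)%E; first exact: product_measure1E.
    rewrite P_Om mul1e; exact: probability_setT.
have /choice[z zP] : forall j, exists zj : R, 0 <= zj /\ G zj = a j.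
  by move=> j; have [z z0 Gz] := f_onto (a01 j); exists z; split.
(* The levels prescribed along the enumeration of [J], carried back to ['I_k] with value 0 off [J];
   [ord0] is the slot of [X_i]. *)
pose zJ j := \sum_(j' < #|J| | enum_val j' == j) z (lift ord0 j').
have zJ0 j : 0 <= zJ j by apply: sumr_ge0 => j' _; case: (zP (lift ord0 j')).
have zJE j' : zJ (enum_val j') = z (lift ord0 j').
  rewrite /zJ (big_pred1 j')// => j''.
  by apply/eqP/eqP => [/enum_val_inj|->].
have [z0 Gz0] := zP ord0.
pose B := [set v : #|J|.-tuple R | forall j, tnth v j <= a (lift ord0 j)].
have mB : measurable B.
  rewrite (_ : B = \bigcap_(j in setT) ((fun v : #|J|.-tuple R => tnth v j) @^-1` `]-oo, a (lift ord0 j)])).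
    apply: fin_bigcap_measurable => // j _; rewrite -[X in measurable X]setTI.
    exact: measurable_tnth.
  by apply/seteqP; split => v h j; [move=> _; rewrite /= in_itv; exact: h|have := h j I; rewrite /= in_itv].
pose A' := [set w | forall j, j \in J -> tnth (X w) j <= f 0%N (zJ j)].
have A'E : A' = Z @^-1` B.
  apply/seteqP; split => w h.
    move=> j; rewrite tnth_mktuple -(zP (lift ord0 j)).2 -zJE; apply: h; exact: enum_valP.
  move=> j jJ; have := h (enum_rank_in jJ j).
  by rewrite tnth_mktuple enum_rankK_in// -(zP (lift ord0 _)).2 -zJE enum_rankK_in.
transitivity (P (A' `&` slab X G i (z ord0))).
  congr (P _); apply/seteqP; split => w.
    by move=> /(tnth_cons _ _ (fun j c => c <= a j))[h1 h2]; rewrite A'E /slab /= Gz0.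
  rewrite A'E => -[h2 h1]; apply/(tnth_cons _ _ (fun j c => c <= a j)).
  by rewrite -Gz0.
rewrite (orthant_prob mX lo0 tw f0 surv_f surv_r survivalX iJ Jn r_lc r_mod)//.
transitivity (\int[P]_(w in A') kappa (Z w) `]-oo, G (z ord0)]%classic)%E; last first.
  rewrite A'E -prod_kappa//; congr ((P \x U)%E _); apply/seteqP; split => wu /=.
    by move=> [h1 h2]; apply/(tnth_cons _ _ (fun j c => c <= a j)); rewrite -Gz0; rewrite in_itv in h1.
  by move=> /(tnth_cons _ _ (fun j c => c <= a j))[h1 h2]; rewrite in_itv/= Gz0.
have mA' : measurable A' by rewrite A'E -[X in measurable X]setTI; exact: mZ.
(* The integrands agree on [Om]; off it [pos] may fail, and [kappa] is then a Dirac mass. *)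
apply: ge0_ae_eq_integral => //.
- exact: (measurable_surv_ratio mX surv_f surv_r).
- apply: measurable_funTS.
  exact: (measurableT_comp (measurable_kernel kappa _ (measurable_itv _)) mZ).
- by move=> w _; rewrite lee_fin (surv_ratio_ge0 surv_r)// sigmaE.
- exists (~` Om); split; first exact: measurableC.
    by have := probability_setC P mOm; rewrite P_Om subee.
  by move=> w H Omw; apply: H => _; rewrite kappa_cdf ?Om_pos// sigmaE.
Qed.

Lemma survival_stoch_increasing :
  stoch_increasing P (fun w => tnth (X w) i) (fun w => subvec J (X w)).
Proof.
exists kappa => [B E mB mE|y y01 s t]; last exact: kappa_noninc.
pose V := [set v : #|J|.+1.-tuple R | E (thead v) /\ B [tuple of behead v]].
have mV : measurable V.
  apply: measurableI.
    by rewrite -[X in measurable X]setTI; exact: measurable_tnth.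
  by rewrite -[X in measurable X]setTI; exact: measurable_behead.
have ZE w : [tuple of behead (Y1 w)] = Z w by apply: val_inj.
have ZE2 wu : [tuple of behead (Y2 wu)] = Z wu.1 by apply: val_inj.
have := joint mV; rewrite -/Z -prod_kappa//.
rewrite (_ : Y1 @^-1` V = Z @^-1` B `&` (fun w => tnth (X w) i) @^-1` E).
  move=> ->; congr ((P \x U)%E _); apply/seteqP; split => wu.
    by rewrite /V/= ZE2.
  by rewrite /V/= ZE2.
apply/seteqP; split => w.
  by rewrite /V/= ZE => -[].
by move=> [h1 h2]; rewrite /V/= ZE.
Qed.

End survival_stoch_increasing.

(** * Conditional copulas *)

Section onto.
Context {R : realType} (h : R -> R).
Hypotheses (h0 : h 0 = 1) (h_small : forall e : R, 0 < e -> exists2 t, 0 <= t & h t < e).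

Lemma decreasing_onto c : (forall M, {within `[0, M], continuous h}) -> 0 < c <= 1 ->
  exists2 z, 0 <= z & h z = c.
Proof.
move=> ch /andP[c0 c1]; have [M M0 hM] := h_small c0.
have [|z] := IVT M0 (ch M) (v := c); last by rewrite in_itv/= => /andP[z0 _]; exists z.
by rewrite h0 ge_min le_max (ltW hM) c1 orbT.
Qed.

End onto.

(** This covers the top level, where the tower offers no two-sided continuity. *)
Lemma log_convex_continuous {R : realType} (lo t : R) (r : R -> R) :
  (forall u, lo < u -> 0 < r u) -> (forall a b, lo < a -> a <= b -> r b <= r a) ->
  log_convex_from lo r -> lo < t -> {for t, continuous r}.
Proof.
move=> r0 rni lc lt0; pose c := (lo + t) / 2.
have lc0 : lo < c by rewrite /c; lra.
have ct : c < t by rewrite /c; lra.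
apply/cvgrPdist_le => e e0.
have [d d0 Hd] := log_convex_modulus lc0 e0 r0 rni lc.
near=> x.
have xc : c <= x by apply/ltW; near: x; exact: lt_nbhsr.
have xt : `|t - x| <= d by near: x; exact: cvgr_dist_le.
move: xt; rewrite ler_norml => /andP[h1 h2].
have [tx|/ltW xt] := leP t x.
  rewrite ger0_norm ?subr_ge0 ?rni//.
  by apply: Hd => //; [exact: ltW|lra].
rewrite distrC ger0_norm ?subr_ge0 ?rni//; last exact: lt_le_trans xc.
by apply: Hd => //; lra.
Unshelve. all: by end_near. Qed.

(** Moving the left end from [lo = 0] to [- s] makes 0 an interior point; [K] will normalize the
    value at 0 to 1. *)
Lemma tower_shift {R : realType} (lo s K : R) (n l : nat) (f : nat -> R -> R) :
  0 < K -> (l <= n)%N -> tower lo n f ->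
  tower (lo - s) (n - l) (fun k t => f (l + k)%N (s + t) / K).
Proof.
move=> K0 ln [twd tws tw0]; split.
- move=> k kn t lt0.
  have ltst : lo < s + t by lra.
  have H := twd (l + k)%N ltac:(lia) _ ltst.
  have H3 : is_derive t 1 (fun x : R => s + x) 1.
    by rewrite -[X in is_derive _ _ _ X]add0r; apply: is_deriveD.
  have H1 := @is_derive1_comp _ (f (l + k)%N) (fun x => s + x) _ _ _ H H3.
  have H2 := is_deriveZ K^-1 H1.
  rewrite (_ : (fun t => _) = K^-1 \*: (f (l + k)%N \o (fun x => s + x))); last first.
    by apply/funext => u /=; rewrite mulrC.
  by apply: (is_derive_eq H2); rewrite addnS -[_ *: _]/(_ * _); ring.
- move=> k kn a b la ab.
  have lsa : lo < s + a by lra.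
  have sab : s + a <= s + b by lra.
  have := tws (l + k)%N ltac:(lia) _ _ lsa sab.
  rewrite addnS (_ : s + b - (s + a) = b - a); last ring.
  rewrite -mulrBl ![_ / K * _]mulrAC !ler_pM2r ?invr_gt0//.
- move=> k t kn lt0; rewrite divr_gt0// tw0//; [lia|lra].
Qed.

Section strict_generator.
Context {R : realType} (psi : R -> R).
Hypotheses (gen : generator psi) (strict : strict_generator psi).

Lemma strict_generator_lt a b : 0 <= a -> a < b -> psi b < psi a.
Proof. by move=> a0 ab; apply: (gen_decr gen) => //; rewrite strict leey. Qed.

Lemma gen_pinvK z : 0 <= z -> gen_pinv psi (psi z) = z%:E.
Proof.
move=> z0; rewrite /gen_pinv (_ : [set _ | _ in _] = [set z%:E]) ?ereal_inf1//.
apply/seteqP; split => [_ [z' [z'0 zz'] <-]|_ ->]; last by exists z.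
congr (_%:E); case: (ltgtP z' z) => // h.
  by have := strict_generator_lt z'0 h; rewrite zz' ltxx.
by have := strict_generator_lt z0 h; rewrite zz' ltxx.
Qed.

Lemma sum_pinvE n (u : n.-tuple R) (z : 'I_n -> R) : (forall i, 0 <= z i) ->
  (forall i, tnth u i = psi (z i)) -> sum_pinv psi u = (\sum_i z i)%:E.
Proof.
move=> z0 uz; rewrite /sum_pinv -sumEFin; apply: eq_bigr => i _.
by rewrite uz gen_pinvK.
Qed.

Lemma strict_generator_onto c : 0 < c <= 1 -> exists2 z, 0 <= z & psi z = c.
Proof.
apply: decreasing_onto; first exact: gen_at0.
  by move=> e e0; have [t t0 te] := generator_small gen e0; exists t => //; exact: ltW.
move=> M; apply: continuous_subspaceW (gen_cont gen).
by move=> z /=; rewrite !in_itv/= andbT => /andP[].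
Qed.

End strict_generator.

Section conditional_copula.
Context {R : realType} (d l : nat) (psi : R -> R) (C : d.-tuple R -> R).
Hypotheses (hl : (1 <= l <= d - 2)%N) (hC : archimedean_copula psi C)
  (strict : strict_generator psi) (hCI : conditionally_increasing C).

Let gen : generator psi. Proof. by case: hC. Qed.
Let dmon : d_monotone d psi. Proof. by case: hC. Qed.
Let d2 : (2 <= d)%N. Proof. by move/andP: hl => []; lia. Qed.
Let n := d.-1.
Let f := psi_tower d psi.
Let tw : tower 0 n f. Proof. exact: tower_psi_tower. Qed.

Let f0E : f 0%N = psi.
Proof. by apply/funext => z; rewrite /f psi_towerE// expr0 mul1r derive1n0. Qed.

(** The first [m] coordinates are conditioned on and the next one is observed; [m <= d - 1] leaves
    room for it, and an empty [J] would say nothing. *)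
Let f_log_convex m : (0 < m <= n)%N -> log_convex_from 0 (f m).
Proof.
move=> /andP[m0 mn].
have [_ _ [mu law] CE] := hC.
have md : (m < d)%N by rewrite /n in mn; lia.
pose J := [set widen_ord (ltnW md) j | j in 'I_m]%SET.
have JE : #|J| = m.
  rewrite card_imset ?card_ord//.
  by move=> i j /(congr1 val)/= ij; exact: val_inj.
pose i := Ordinal md.
have iJ : i \notin J.
  by apply/imsetP => -[j _ /(congr1 val)/= mj]; have := ltn_ord j; rewrite -mj ltnn.
pose X : {RV mu >-> d.-tuple R} := mfun_of (@measurable_id _ _ setT).
have Xlaw : copula_law C (distribution mu X) by exact: law.
have Xinc := hCI Xlaw iJ.
have survX z : (forall i, 0 <= z i) ->
    mu [set w | forall i, tnth (X w) i <= f 0%N (z i)] = (f 0%N (\sum_i z i))%:E.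
  move=> z0; pose u := [tuple psi (z i) | i < d].
  have uz j : tnth u j = psi (z j) by rewrite tnth_mktuple.
  have cu : in_cube u by move=> j; rewrite uz (gen_range gen).
  have := law.2 u cu; rewrite CE// (sum_pinvE gen strict z0 uz)/= f0E => <-.
  by congr (mu _); apply/seteqP; split => w h j; have := h j; rewrite uz.
have rc : right_continuous_from 0 (f m) by exact: psi_tower_right_continuous.
apply: log_convex_from_shifted => //; first by move=> t t0; rewrite (tower_gt0 tw).
move=> t t' y x t0 x0 tt' y0; rewrite -JE.
apply: (@stoch_increasing_shifted _ _ _ mu _ X n f _ _ _ survX tw J i iJ) => //.
- by move=> a b a0 ab; rewrite f0E (gen_noninc gen).
- by rewrite f0E (gen_at0 gen).
- by rewrite JE.
- by rewrite JE.
Qed.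

Variable x : l.-tuple R.
Hypothesis hx : forall i : 'I_l, 0 < tnth x i < 1.

Let sum_pinv_gt0 : exists2 s : R, 0 < s & sum_pinv psi x = s%:E.
Proof.
have /choice[z zP] : forall i, exists z : R, 0 < z /\ psi z = tnth x i.
  move=> i; have /andP[x0 x1] := hx i.
  have [z z0 zx] := strict_generator_onto gen (introT andP (conj x0 (ltW x1))).
  exists z; split => //; rewrite lt_neqAle z0 andbT; apply/eqP => z00.
  by move: x1; rewrite -zx -z00 (gen_at0 gen) ltxx.
exists (\sum_i z i); last first.
  by apply: sum_pinvE => // i; [exact/ltW/(zP i).1|rewrite (zP i).2].
have l0 : (0 < l)%N by case/andP: hl.
rewrite (bigD1 (Ordinal l0))//= ltr_pwDl ?(zP _).1// sumr_ge0// => i _.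
exact/ltW/(zP i).1.
Qed.

Lemma cond_copula_conditionally_increasing :
  conditionally_increasing (@cond_copula R psi l x (d - l)).
Proof.
move=> dT T P X Xlaw J i iJ.
have [s s0 sE] := sum_pinv_gt0.
have ln : (l <= n)%N by move/andP: hl => []; rewrite /n; lia.
pose K := f l s.
have K0 : 0 < K by rewrite /K (tower_gt0 tw).
pose g k t := f (l + k)%N (s + t) / K.
have twg : tower (0 - s) (n - l) g by exact: tower_shift.
have lo0 : 0 - s < 0 by lra.
have n0 : (0 < n - l)%N by move/andP: hl => []; rewrite /n; lia.
have g0 : g 0%N 0 = 1 by rewrite /g addn0 addr0 divff// gt_eqF.
have g_pos k t : (k <= n - l)%N -> 0 - s < t -> 0 < g k t.
  by move=> kn st; rewrite (tower_gt0 twg).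
have g_noninc k a b : (k <= n - l)%N -> 0 - s < a -> a <= b -> g k b <= g k a.
  move=> kn sa ab; rewrite /g ler_pM2r ?invr_gt0//.
  have : (l + k).-1.+1 = (l + k)%N by move/andP: hl => []; lia.
  have : ((l + k).-1 < n)%N by move: hl kn; rewrite /n; lia.
  move=> lkn <-; apply: slope_between_noninc (tower_slope tw lkn) _ _; lra.
(* [1 <= l] makes the index [l + k] positive, as [f_log_convex] demands. *)
have g_lc k : (k <= n - l)%N -> log_convex_from (0 - s) (g k).
  move=> kn t t' y st tt' y0.
  rewrite /g mulrACA [leRHS]mulrACA ler_pM2r; last by rewrite mulr_gt0// invr_gt0.
  rewrite !addrA; apply: f_log_convex => //; [|lra|lra].
  by move: hl kn; rewrite /n; lia.
have g_cont k t : (k <= n - l)%N -> 0 - s < t -> {for t, continuous (g k)}.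
  move=> kn st; apply: (@log_convex_continuous _ (0 - s)) => //.
  - by move=> u; exact: g_pos.
  - by move=> a b; exact: g_noninc.
  - exact: g_lc.
have g_small k e : (k <= n - l)%N -> 0 < e -> exists2 t, 0 <= t & g k t < e.
  move=> kn e0; have lkn : (l + k <= n)%N by move: hl kn; rewrite /n; lia.
  have [t t0 te] := psi_tower_small d2 gen strict dmon lkn (mulr_gt0 e0 K0).
  exists t; first exact: ltW.
  rewrite /g ltr_pdivrMr//; apply: le_lt_trans te.
  have := g_noninc k (t - s) t kn; rewrite /g ler_pM2r ?invr_gt0// subrKC.
  by apply; lra.
have surv_g k : (k <= n - l)%N -> survival_function (g k).
  move=> kn; split.
  - by move=> a b a0; apply: g_noninc => //; lra.
  - by move=> t t0; apply: g_cont => //; lra.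
  - by move=> t t0; apply: g_pos => //; lra.
  - by move=> e; exact: g_small.
have g_onto c : 0 < c <= 1 -> exists2 z, 0 <= z & g 0%N z = c.
  apply: decreasing_onto => //; first by move=> e; exact: g_small.
  move=> M; apply: continuous_in_subspaceT => z; rewrite inE/= in_itv/= => /andP[z0 _].
  by apply: g_cont => //; lra.
have g_mod k e : (k <= n - l)%N -> 0 < e -> exists2 d : R, 0 < d & forall a b, 0 <= a -> a <= b ->
    b <= a + d -> g k a - g k b <= e.
  move=> kn e0; apply: log_convex_modulus lo0 e0 _ _ (g_lc k kn).
  - by move=> t; exact: g_pos.
  - by move=> a b; exact: g_noninc.
have g_lt a b : 0 <= a -> a < b -> g 0%N b < g 0%N a.
  by move=> a0; apply: (tower_decreasing twg n0); lra.
have ratioE t : 0 <= t -> derive1n l psi (s + t) / derive1n l psi s = g 0%N t.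
  move=> t0; rewrite /g /K addn0 /f !psi_towerE; [|lia|lia].
  by rewrite -mulf_div divff ?mul1r// signr_eq0.
have marginE z : 0 <= z -> markov_margin psi x (psi z) = g 0%N z.
  by move=> z0; rewrite /markov_margin sE gen_pinvK//= ratioE.
have margin0 : markov_margin psi x 0 = 0.
  by rewrite /markov_margin sE strict/= mul0r.
(* [markov_quantile] inverts the margin once this is injective on [[0, 1]]; the point 0 has infinite
   pseudoinverse and is treated apart. *)
have margin_inj : {in (`[0, 1]%classic : set R) &, injective (markov_margin psi x)}.
  have cases y : y \in (`[0, 1]%classic : set R) -> y = 0 \/ exists2 z, 0 <= z & psi z = y.
    rewrite inE/= in_itv/= => /andP[y0 y1].
    move: y0; rewrite le_eqVlt => /predU1P[<-|y0]; [by left|right].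
    by apply: strict_generator_onto => //; rewrite y0.
  have gp z : 0 <= z -> g 0%N z != 0 by move=> z0; rewrite gt_eqF// g_pos//; lra.
  move=> y y' /cases[->|[z z0 <-]] /cases[->|[z' z'0 <-]]//.
  - by rewrite margin0 marginE// => /esym/eqP; rewrite (negbTE (gp _ z'0)).
  - by rewrite margin0 marginE// => /eqP; rewrite (negbTE (gp _ z0)).
  - rewrite !marginE// => gz; case: (ltgtP z z') => [h|h|->//].
      by have := g_lt _ _ z0 h; rewrite gz ltxx.
    by have := g_lt _ _ z'0 h; rewrite gz ltxx.
have quantileE z : 0 <= z -> markov_quantile psi x (g 0%N z) = psi z.
  move=> z0; rewrite -marginE// /markov_quantile pinvKV//.
  by rewrite inE/= in_itv/= (gen_range gen).
(* The quantiles turn [g 0 (z i)] into [psi (z i)], whose pseudoinverses sum to [\sum_i z i]: the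
   conditional copula has Archimedean form with [g 0] in place of [psi]. *)
have survX z : (forall i, 0 <= z i) ->
    P [set w | forall i, tnth (X w) i <= g 0%N (z i)] = (g 0%N (\sum_i z i))%:E.
  move=> z0; pose u := [tuple g 0%N (z i) | i < d - l].
  have uz j : tnth u j = g 0%N (z j) by rewrite tnth_mktuple.
  have cu : in_cube u.
    move=> j; rewrite uz ltW ?g_pos//=; last by have := z0 j; lra.
    by rewrite -g0 g_noninc//; lra.
  have := Xlaw.2 u cu.
  rewrite /cond_copula /markov_df sE (@sum_pinvE _ _ gen strict _ _ z)//; last first.
    by move=> j; rewrite tnth_mktuple uz quantileE.
  rewrite /= ratioE ?sumr_ge0// => <-.
  by congr (P _); apply/seteqP; split => w h j; have := h j; rewrite /= uz.
(* As [i] lies outside [J], the level [l + #|J|] does not exceed the top [d - 1] of the tower. *)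
have Jn : (#|J| <= n - l)%N.
  suff : (#|J| < d - l)%N by move/andP: hl => []; rewrite /n; lia.
  by rewrite -[X in (_ < X)%N]card_ord -cardsT; apply: proper_card; rewrite properE finset.subsetT; apply/fintype.subsetPn; exists i.
apply: (@survival_stoch_increasing _ _ _ P _ X (0 - s) (n - l) g J i) => //.
- exact: surv_g.
- exact: surv_g.
- exact: g_lc.
- by move=> e; exact: g_mod.
Qed.

End conditional_copula.

Theorem proposition6p10 (R : realType) (d l : nat) (psi : R -> R)
    (C : d.-tuple R -> R)
    (hl : (1 <= l <= d - 2)%N)
    (hC : archimedean_copula psi C)
    (hstrict : strict_generator psi)
    (hCI : conditionally_increasing C)
    (x : l.-tuple R)
    (hx : forall i : 'I_l, 0 < tnth x i < 1) :
  conditionally_increasing (@cond_copula R psi l x (d - l)).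
Proof. exact: (cond_copula_conditionally_increasing hl hC hstrict hCI hx). Qed.
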